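(* Let $(\mathcal{X},\mathbf{d})$ be a compact metric space, $T\colon \mathbb{R}^d\times \mathcal{X}\to \mathcal{X}$ a continuous action of $\mathbb{R}^d$, and $\varphi\colon \mathcal{X}\to \mathbb{R}$ a continuous function. For any $T$-invariant Borel probability measure $\mu$ on $\mathcal{X}$ we have $$\overline{\mathrm{rdim}}(\mathcal{X},T,\mathbf{d},\mu) +\int_{\mathcal{X}}\varphi\, d\mu \leq \overline{\mathrm{mdim}}_{\mathrm{M}}(\mathcal{X},T,\mathbf{d},\varphi),$$ $$\underline{\mathrm{rdim}}(\mathcal{X},T,\mathbf{d},\mu) + \int_{\mathcal{X}}\varphi\, d\mu \leq \underline{\mathrm{mdim}}_{\mathrm{M}}(\mathcal{X},T,\mathbf{d},\varphi).$$
   Context: Conventions. $d\ge 1$ is a natural number, $\mathbf{m}$ is Lebesgue measure on $\mathbb{R}^d$ (also written $du$), $\log=\log_2$. We write $T^u x=T(u,x)$, with $T^{u+v}=T^uT^v$, $T^0=\mathrm{id}$. $\mu$ is $T$-invariant if $\mu(T^{-u}A)=\mu(A)$ for all $u\in\mathbb{R}^d$ and Borel $A$. Limits may take infinite values. Metric mean dimension with potential. For a compact metric space $(\mathcal{X},\mathbf{d})$, continuous $\varphi\colon\mathcal{X}\to\mathbb{R}$ and $\varepsilon>0$, $$\#(\mathcal{X},\mathbf{d},\varphi,\varepsilon)=\inf\Big\{\sum_{i=1}^n(1/\varepsilon)^{\sup_{U_i}\varphi}\ :\ \mathcal{X}=U_1\cup\dots\cup U_n\text{ an open cover with }\mathrm{Diam}\,U_i<\varepsilon\text{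 for all }i\Big\}.$$ For $L>0$ put $\mathbf{d}_L(x,y)=\sup_{u\in[0,L)^d}\mathbf{d}(T^ux,T^uy)$ and $\varphi_L(x)=\int_{[0,L)^d}\varphi(T^ux)\,du$. Then $$\overline{\mathrm{mdim}}_{\mathrm{M}}(\mathcal{X},T,\mathbf{d},\varphi)=\limsup_{\varepsilon\to0}\left(\lim_{L\to\infty}\frac{\log\#(\mathcal{X},\mathbf{d}_L,\varphi_L,\varepsilon)}{L^d\log(1/\varepsilon)}\right),$$ and $\underline{\mathrm{mdim}}_{\mathrm{M}}(\mathcal{X},T,\mathbf{d},\varphi)$ is defined by the same formula with $\liminf_{\varepsilon\to0}$ (the limits in $L$ exist). Mutual information. For a random variable $X$ with values in a finite set, $H(X)=-\sum_x\mathbb{P}(X=x)\log\mathbb{P}(X=x)$ ($0\log0=0$). For $X,Y$ with values in finite sets (with discrete $\sigma$-algebras), $I(X;Y)=H(X)+H(Y)-H(X,Y)$. For measurable $X,Y$ with values in arbitrary measurable spaces, $I(X;Y)\in[0,\infty]$ is the supremum of $I(f(X);g(Y))$ over all measurable maps $f,g$ to finite sets. Rate distortion dimension. For a Borel set $A\subset\mathbb{R}^d$ of finite measure, $L^1(A,\mathcal{X})$ is the space of measurable maps $f\colon A\to\mathcal{X}$ modulo a.e. equality, with metric $D(f,g)=\int_A\mathbf{d}(f(u),g(u))\,du$ and its Borel $\sigma$-algebra. For $\varepsilon>0$ and a bounded Borel set $A$ with $\mathbf{m}(A)>0$, $R(\varepsilon,A)$ is the infimum of $I(X;Y)$ over all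 pairs of random variables defined on some probability space such that $X$ takes values in $\mathcal{X}$ with law $\mu$, and $Y$ takes values in $L^1(A,\mathcal{X})$ with $\mathbb{E}\big(\frac1{\mathbf{m}(A)}\int_A\mathbf{d}(T^uX,Y_u)\,du\big)<\varepsilon$, where $Y_u$ is the value of $Y$ at $u$. The rate distortion function is $R(\mathbf{d},\mu,\varepsilon)=\lim_{L\to\infty}R(\varepsilon,[0,L)^d)/L^d$ (the limit exists), and $$\overline{\mathrm{rdim}}(\mathcal{X},T,\mathbf{d},\mu)=\limsup_{\varepsilon\to0}\frac{R(\mathbf{d},\mu,\varepsilon)}{\log(1/\varepsilon)},\qquad \underline{\mathrm{rdim}}(\mathcal{X},T,\mathbf{d},\mu)=\liminf_{\varepsilon\to0}\frac{R(\mathbf{d},\mu,\varepsilon)}{\log(1/\varepsilon)}.$$ *)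

(* Defs.v *)
From HB Require Import structures.
From mathcomp Require Import all_boot all_order all_algebra.
From mathcomp Require Import all_classical all_reals all_analysis.
From mathcomp Require Import measurable_realfun.

Set Implicit Arguments.
Unset Strict Implicit.
Unset Printing Implicit Defensive.

Import Order.TTheory GRing.Theory Num.Theory.
Import numFieldNormedType.Exports.

Local Open Scope classical_set_scope.
Local Open Scope ring_scope.

(* Measurable types are pointed in the library; a space carrying a probability
   measure is nonempty, so nothing is lost by working with pointed metric
   spaces. *)
#[short(type="pmetricType")]
HB.structure Definition PointedMetric (K : numDomainType) :=
  {M of Metric K M & Pointed M}.

Definition borel (S : ptopologicalType) := g_sigma_algebraType (@open S).
HB.instance Definition _ (S : ptopologicalType) := Measurable.on (borel S).

Notation Rn R d := (borel 'rV[R]_d).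

Section euclidean_measurability.
Context {R : realType}.

Lemma measurable_coord (n : nat) (i : 'I_n) :
  measurable_fun [set: Rn R n] (fun v : Rn R n => (v : 'rV[R]_n) ord0 i).
Proof.
apply: (measurability _ (RGenOpens.measurableE R)).
move=> _ [_ [a [b ->] <-]]; rewrite setTI.
apply: sub_sigma_algebra.
by apply: (@open_comp _ _ (fun v : 'rV[R]_n => v ord0 i)) => [v _|];
  [exact: coord_continuous|exact: interval_open].
Qed.

Lemma measurable_fun_rV d (S : measurableType d) (n : nat)
    (f : S -> Rn R n) :
  (forall i, measurable_fun [set: S] (fun x => (f x : 'rV[R]_n) ord0 i)) ->
  measurable_fun [set: S] f.
Proof.
move=> mf; apply: (@measurability _ _ _ (Rn R n) _ _ (@open 'rV[R]_n)) => //.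
move=> _ [U oU <-]; rewrite setTI.
pose box (p : 'rV[rat]_n * nat) : set 'rV[R]_n :=
  [set v | forall i, `|v ord0 i - ratr (p.1 ord0 i)| < p.2.+1%:R^-1].
have -> : f @^-1` U =
    \bigcup_(p in [set p | box p `<=` U]) (f @^-1` box p).
  apply/seteqP; split=> [x Ux|x [p pU px]]; last exact: pU.
  have /nbhs_ballP[e /= e0 eU] : nbhs (f x : 'rV[R]_n) U by exact: open_nbhs_nbhs.
  have [k ke] : exists k : nat, k.+1%:R^-1 < e / 2 :> R.
    have e2 : 0 < e / 2 by rewrite divr_gt0.
    exists (Num.truncn (e / 2)^-1).
    rewrite -[ltRHS]invrK ltf_pV2 ?posrE ?invr_gt0//.
    by rewrite -truncn_lt_nat// invr_ge0 ltW.
  have q_ i : exists q : rat,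
      `|(f x : 'rV[R]_n) ord0 i - ratr q| < k.+1%:R^-1 :> R.
    have [|q] := @rat_in_itvoo R ((f x : 'rV[R]_n) ord0 i - k.+1%:R^-1)
      ((f x : 'rV[R]_n) ord0 i + k.+1%:R^-1).
      by rewrite ltrBlDr -addrA ltrDl addr_gt0.
    rewrite in_itv /= => /andP[h1 h2]; exists q.
    by rewrite ltr_norml; apply/andP; split;
      [rewrite ltrBrDl ltrBlDr|rewrite ltrBlDl -ltrBlDr].
  exists (\row_i sval (cid (q_ i)), k) => [v bv|i] /=; last first.
    by rewrite mxE; case: cid.
  apply: eU; split=> // a i; rewrite (ord1 a) /ball /=.
  have := bv i; rewrite /= mxE; case: cid => q /= hq hv.
  rewrite -(subrK (ratr q) (f x ord0 i)) -addrA.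
  rewrite (le_lt_trans (ler_normD _ _))// [e]splitr ltrD//.
    exact: lt_trans ke.
  by rewrite distrC; exact: lt_trans ke.
rewrite bigcup_mkcond; apply: countable_bigcupT_measurable => [|p].
  exact: countableP.
case: ifPn => // _.
rewrite [X in measurable X](_ : _ = \bigcap_(i in [set: 'I_n])
  [set x | `|(f x : 'rV[R]_n) ord0 i - ratr (p.1 ord0 i)| < p.2.+1%:R^-1]);
  last by apply/seteqP; split => [x h i _|x h i]; apply: h.
apply: fin_bigcap_measurable => // i _.
have mi : measurable_fun [set: S]
    (fun x => `|(f x : 'rV[R]_n) ord0 i - ratr (p.1 ord0 i)|).
  by apply: measurableT_comp => //; apply: measurable_funB.
have := mi measurableT `]-oo, p.2.+1%:R^-1[%classic (measurable_itv _).
by rewrite setTI; congr measurable.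
Qed.


Definition box n (a b : 'rV[R]_n) : set (Rn R n) :=
  [set v : 'rV[R]_n | forall i, v ord0 i \in `[a ord0 i, b ord0 i[].

Lemma measurable_box n (a b : 'rV[R]_n) : measurable (box a b).
Proof.
rewrite (_ : box a b = \bigcap_(i in [set: 'I_n])
    ((fun v : Rn R n => (v : 'rV[R]_n) ord0 i) @^-1`
      `[a ord0 i, b ord0 i[%classic)); last first.
  by apply/seteqP; split => [v h i _|v h i]; apply: h.
apply: fin_bigcap_measurable => // i _.
by rewrite -[X in measurable X]setTI; apply: measurable_coord.
Qed.

Definition vcons (n : nat) (p : measurableTypeR R * Rn R n) : Rn R n.+1 :=
  \row_i oapp ((p.2 : 'rV[R]_n) ord0) p.1 (unlift ord0 i).

Definition vuncons (n : nat) (v : Rn R n.+1) : measurableTypeR R * Rn R n :=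
  ((v : 'rV[R]_n.+1) ord0 ord0, \row_i (v : 'rV[R]_n.+1) ord0 (lift ord0 i)).

Lemma vconsK n : cancel (@vcons n) (@vuncons n).
Proof.
move=> [t v]; rewrite /vuncons /vcons mxE unlift_none /=; congr pair.
by apply/rowP => i; rewrite !mxE liftK.
Qed.

Lemma vunconsK n : cancel (@vuncons n) (@vcons n).
Proof.
move=> v; apply/rowP => i; rewrite mxE.
by case: unliftP => [j|] -> /=; rewrite ?mxE.
Qed.

Lemma measurable_vcons n : measurable_fun setT (@vcons n).
Proof.
apply: measurable_fun_rV => i; rewrite /vcons.
under eq_fun do rewrite mxE.
case: unlift => [j|] /=; last exact: measurable_fst.
exact: (measurableT_comp (measurable_coord j) measurable_snd).
Qed.

Lemma measurable_vuncons n : measurable_fun setT (@vuncons n).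
Proof.
apply: measurable_fun_pair; first exact: measurable_coord.
apply: measurable_fun_rV => i.
under eq_fun do rewrite mxE.
exact: measurable_coord.
Qed.

HB.instance Definition _ n :=
  isMeasurableFun.Build _ _ _ _ (@vcons n) (@measurable_vcons n).

End euclidean_measurability.

Section lebesgue_step.
Context {R : realType} (n : nat).
Variable m : {sigma_finite_measure set (Rn R n) -> \bar R}.

(* Product of Lebesgue measure on R with [m], transported along the bijection
   R * R^n -> R^(n+1). *)
Definition lebesgue_step : set (Rn R n.+1) -> \bar R :=
  pushforward (@lebesgue_measure R \x m)%E (@vcons R n).

Let lebesgue_step0 : lebesgue_step set0 = 0%E.
Proof. by rewrite /lebesgue_step /pushforward preimage_set0 measure0. Qed.

Let lebesgue_step_ge0 A : (0 <= lebesgue_step A)%E.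
Proof. exact: measure_ge0. Qed.

Let mpre A : measurable A -> measurable (@vcons R n @^-1` A).
Proof.
by move=> mA; rewrite -[X in measurable X]setTI; exact: measurable_vcons.
Qed.

Let lebesgue_step_sigma_additive : semi_sigma_additive lebesgue_step.
Proof.
move=> F mF tF mUF; rewrite /lebesgue_step /pushforward preimage_bigcup.
apply: measure_semi_sigma_additive.
- by move=> k; exact: mpre.
- apply/trivIsetP => /= i j _ _ ij; rewrite -preimage_setI.
  by move/trivIsetP : tF => /(_ _ _ _ _ ij) ->//; rewrite preimage_set0.
- by rewrite -preimage_bigcup; exact: mpre.
Qed.

HB.instance Definition _ := isMeasure.Build _ _ _ lebesgue_step
  lebesgue_step0 lebesgue_step_ge0 lebesgue_step_sigma_additive.

Lemma lebesgue_stepX (A : set (measurableTypeR R)) (B : set (Rn R n)) :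
  measurable A -> measurable B ->
  lebesgue_step (@vuncons R n @^-1` (A `*` B)) = (lebesgue_measure A * m B)%E.
Proof.
move=> mA mB; rewrite /lebesgue_step /pushforward.
rewrite (_ : _ @^-1` _ = A `*` B) ?product_measure1E//.
by apply/funext => p; rewrite /preimage /mkset vconsK.
Qed.

Let lebesgue_step_sigma_finite : sigma_finite setT lebesgue_step.
Proof.
have /sigma_finiteP[F [TF ndF Foo]] := sigma_finiteT (@lebesgue_measure R).
have /sigma_finiteP[G [TG ndG Goo]] := sigma_finiteT m.
exists (fun k => @vuncons R n @^-1` (F k `*` G k)).
  apply/seteqP; split => // v _.
  have [i _ Fi] : (\bigcup_k F k) (@vuncons R n v).1 by rewrite -TF.
  have [j _ Gj] : (\bigcup_k G k) (@vuncons R n v).2 by rewrite -TG.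
  exists (maxn i j) => //; split.
  - by move: Fi; exact/subsetPset/ndF/leq_maxl.
  - by move: Gj; exact/subsetPset/ndG/leq_maxr.
move=> k; have [mF Fk] := Foo k; have [mG Gk] := Goo k; split.
  rewrite -[X in measurable X]setTI.
  by apply: measurable_vuncons => //; exact: measurableX.
by rewrite lebesgue_stepX// lte_mul_pinfty// ge0_fin_numE.
Qed.

HB.instance Definition _ :=
  @Measure_isSigmaFinite.Build _ _ _ lebesgue_step lebesgue_step_sigma_finite.

End lebesgue_step.

Fixpoint lebesgueRn (R : realType) (n : nat) :
    {sigma_finite_measure set (Rn R n) -> \bar R} :=
  if n is k.+1 then lebesgue_step (lebesgueRn R k)
  else dirac (0 : Rn R 0).

Lemma lebesgueRn_box (R : realType) (n : nat) (a b : 'rV[R]_n) :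
  (forall i, a ord0 i <= b ord0 i) ->
  lebesgueRn R n (box a b) = (\prod_(i < n) (b ord0 i - a ord0 i))%:E.
Proof.
elim: n a b => [|n IH] a b ab.
  by rewrite big_ord0 /= diracE mem_set// => -[].
pose t (c : 'rV[R]_n.+1) : 'rV[R]_n := \row_i c ord0 (lift ord0 i).
rewrite big_ord_recl EFinM.
have IHt := IH (t a) (t b).
have -> : (\prod_(i < n) (b ord0 (lift ord0 i) - a ord0 (lift ord0 i)) =
  \prod_(i < n) (t b ord0 i - t a ord0 i))%R.
  by apply: eq_bigr => i _; rewrite !mxE.
rewrite -IHt; last by move=> i; rewrite !mxE.
rewrite [LHS]/=.
set A : set (measurableTypeR R) := `[a ord0 ord0, b ord0 ord0[%classic.
set B := box (t a) (t b).
rewrite (_ : box a b = @vuncons R n @^-1` (A `*` B)); last first.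
  apply/seteqP; split=> v /=.
    move=> h; split; first exact: h.
    by move=> i /=; rewrite !mxE; exact: h.
  move=> [h0 h1] i; case: (unliftP ord0 i) => [j|] ->//.
  by have := h1 j; rewrite !mxE.
rewrite lebesgue_stepX.
- congr (_ * _)%E; rewrite lebesgue_measure_itv/= lte_fin.
  by case: ltgtP (ab ord0) => // -> _; rewrite subrr.
- exact: measurable_itv.
- exact: measurable_box.
Qed.

Section metric_cover.
Context {R : realType} {S : Type}.
Implicit Types (D : S -> S -> R) (phi : S -> R).

Definition dist_open D : set (set S) :=
  [set U | forall x, U x -> exists2 r, 0 < r & [set y | D x y < r] `<=` U].

Definition diam D (U : set S) : R := sup [set D x y | x in U & y in U].

(* [sup] of a bounded nonempty set is the usual supremum.  [sup set0 = 0], so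
   an empty member of a cover contributes 1 to the sum and never lowers the
   infimum. *)
Definition cover_sum D phi (eps : R) : R :=
  inf [set s | exists (n : nat) (U : 'I_n -> set S),
    [/\ forall i, dist_open D (U i),
        [set: S] = \bigcup_i U i,
        forall i, diam D (U i) < eps &
        s = \sum_(i < n) (eps^-1) `^ sup [set phi x | x in U i] ] ].

End metric_cover.

Definition log2 {R : realType} (x : R) : R := ln x / ln 2.

Section mutual_information.
Context {R : realType} {dO} {Omega : measurableType dO} (P : probability Omega R).

Definition entropy (U : finType) (X : Omega -> U) : R :=
  - \sum_(u : U) (let p := fine (P (X @^-1` [set u])) in p * log2 p).

Definition mutual_info_fin (U V : finType) (X : Omega -> U) (Y : Omega -> V) : R :=
  entropy X + entropy Y - entropy (fun w => (X w, Y w)).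

(* Measurability into a finite set with its discrete sigma-algebra. *)
Definition fin_measurable {d} {S : measurableType d} {U : finType} (f : S -> U) :=
  forall B : set U, measurable (f @^-1` B).

Definition mutual_info {d1 d2} {S1 : measurableType d1} {S2 : measurableType d2}
    (X : {RV P >-> S1}) (Y : {RV P >-> S2}) : \bar R :=
  ereal_sup [set r | exists (U V : finType) (f : S1 -> U) (g : S2 -> V),
    [/\ fin_measurable f, fin_measurable g &
        r = (mutual_info_fin (f \o X) (g \o Y))%:E] ].

End mutual_information.

Definition continuous_action {R : realType} {d : nat} {X : topologicalType}
    (T : 'rV[R]_d -> X -> X) :=
  [/\ continuous (fun p : 'rV[R]_d * X => T p.1 p.2),
      forall x, T 0 x = x &
      forall u v x, T (u + v) x = T u (T v x)].

Definition invariant_measure {R : realType} {d : nat} {X : ptopologicalType}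
    (T : 'rV[R]_d -> X -> X) (mu : probability (borel X) R) :=
  forall (u : 'rV[R]_d) (A : set (borel X)), measurable A ->
    mu [set T (- u) x | x in A] = mu A.

Section dynamics.
Context {R : realType} {d : nat} {X : pmetricType R}.
Variable T : 'rV[R]_d -> X -> X.

Definition cube (L : R) : set (Rn R d) := box 0 (const_mx L).

Lemma measurable_cube L : measurable (cube L).
Proof. exact: measurable_box. Qed.

Definition dist_sup (L : R) (x y : X) : R :=
  sup [set mdist (T u x) (T u y) | u in cube L].

Definition potential_int (phi : X -> R) (L : R) (x : X) : R :=
  \int[lebesgueRn R d]_(u in cube L) phi (T u x).

Definition mdim_scale (phi : X -> R) (eps : R) : \bar R :=
  lim ((log2 (cover_sum (dist_sup L) (potential_int phi L) eps)
          / (L ^+ d * log2 eps^-1))%:E @[L --> +oo%R]).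

Definition upper_mdim (phi : X -> R) : \bar R :=
  limf_esup (mdim_scale phi) (0 : R)^'+.

Definition lower_mdim (phi : X -> R) : \bar R :=
  limf_einf (mdim_scale phi) (0 : R)^'+.

(* L^1(A, X): total measurable maps modulo equality almost everywhere on A.
   Every measurable map on A extends to a total one by a constant. *)
Definition L1 (A : set (Rn R d)) (mA : measurable A) : Type :=
  {mfun_ mrestr (lebesgueRn R d) mA, Rn R d >-> borel X}.

Definition L1_fun (A : set (Rn R d)) (mA : measurable A) (f : L1 mA) :
  Rn R d -> X := aqEqMfun_to_fun f.

Definition L1_dist (A : set (Rn R d)) (mA : measurable A) (f g : L1 mA) : R :=
  \int[lebesgueRn R d]_(u in A) mdist (L1_fun f u) (L1_fun g u).

HB.instance Definition _ A (mA : measurable A) := Choice.on (L1 mA).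
HB.instance Definition _ A (mA : measurable A) :=
  isPointed.Build (L1 mA) (\pi_(L1 mA) (cst point))%qT.

Definition borel_L1 A (mA : measurable A) :=
  g_sigma_algebraType (dist_open (@L1_dist A mA)).
HB.instance Definition _ A (mA : measurable A) := Measurable.on (borel_L1 mA).

(* [L1_dist], [distortion] and [rate] are meaningful for bounded A of positive
   measure; the integrands below are then bounded when X is compact. *)
Definition distortion A (mA : measurable A) (x : X) (f : L1 mA) : R :=
  (fine (lebesgueRn R d A))^-1 *
    \int[lebesgueRn R d]_(u in A) mdist (T u x) (L1_fun f u).

Variable mu : probability (borel X) R.

Definition rate (eps : R) A (mA : measurable A) : \bar R :=
  ereal_inf [set r | exists (dO : measure_display) (Omega : measurableType dO)
      (P : probability Omega R)
      (x : {RV P >-> borel X}) (y : {RV P >-> borel_L1 mA}),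
    [/\ forall B, measurable B -> distribution P x B = mu B,
        ('E_P[fun w => distortion (x w) (y w)] < eps%:E)%E &
        r = mutual_info x y] ].

Definition rate_distortion (eps : R) : \bar R :=
  lim ((rate eps (measurable_cube L) * ((L ^+ d)^-1)%:E)%E @[L --> +oo%R]).

Definition upper_rdim : \bar R :=
  limf_esup (fun eps => (rate_distortion eps * ((log2 eps^-1)^-1)%:E)%E)
    (0 : R)^'+.

Definition lower_rdim : \bar R :=
  limf_einf (fun eps => (rate_distortion eps * ((log2 eps^-1)^-1)%:E)%E)
    (0 : R)^'+.

End dynamics.

(* Main.v *)
Require Import Defs.
From HB Require Import structures.
From mathcomp Require Import all_boot all_order all_algebra.
From mathcomp Require Import finmap.
From mathcomp Require Import all_classical all_reals all_analysis.
From mathcomp Require Import measurable_realfun.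
From mathcomp Require Import ring lra.

(** Given an open cover of X by sets U_i of small diameter for the metric d_L,
    let J(x) be an index with x in U_(J(x)) and let Y be the orbit segment of a
    chosen point of the fibre of J through X.  The distortion of (X, Y) is
    below epsilon and I(X; Y) <= H(J).  Gibbs' inequality bounds
    H(J) + log(1/epsilon) * sum_i P(J = i) sup_(U_i) phi_L by the logarithm of
    sum_i (1/epsilon)^(sup_(U_i) phi_L), while invariance of mu gives
    L^d * \int phi dmu = \int phi_L dmu <= sum_i P(J = i) sup_(U_i) phi_L.
    Hence R(epsilon, [0, L)^d) + L^d log(1/epsilon) \int phi dmu is at most
    log #(X, d_L, phi_L, epsilon); divide by L^d log(1/epsilon) and let L go to
    infinity, then epsilon to 0. *)

Import Order.TTheory GRing.Theory Num.Theory.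
Import numFieldNormedType.Exports.

Local Open Scope classical_set_scope.
Local Open Scope ring_scope.

Set Implicit Arguments.
Unset Strict Implicit.

(** * Entropy *)

Section entropy_bounds.
Context {R : realType}.

(** The covering side needs a genuine limit: [mdim_scale] is a [lim], and its value says something
    about covers only once convergence in [L] is known. Convergence is obtained from subadditivity
    over cubes with real side lengths: [N ^ d] tiles of side [M] cover a cube of side [L] as soon as
    [L <= N%:R * M]. As [phi] may be negative, the overshoot of the tiles beyond the cube has to be
    paid for, and a bound [B] of [|phi|] provides the price.

    On the information side the probability space is [X] itself with the measure [mu], and the
    source variable is the identity. The approximating variable then depends on the point only
    through a finite label, so its measurability for the Borel sets of the L^1 space reduces to
    measurability of the fibres of that label. *)

Lemma ln2_gt0 : 0 < ln 2 :> R.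
Proof. by rewrite ln_gt0// ltr1n. Qed.

(** Apply [ln z <= z - 1] at [z = w i / (p i * W)] and weight by [p i]: the right-hand sides
    [w i / W - p i] sum to zero. Terms with [p i = 0] are treated apart. *)
Lemma gibbs_inequality (I : finType) (p w : I -> R) :
  (forall i, 0 <= p i) -> \sum_i p i = 1 -> (forall i, 0 < w i) ->
  \sum_i p i * log2 (w i) - \sum_i p i * log2 (p i) <= log2 (\sum_i w i).
Proof.
move=> p0 p1 w0; set W := \sum_i w i.
have [i0 _] : exists i, p i != 0.
  apply: contrapT => pN0; have : \sum_i p i = 0.
    rewrite big1// => i _; apply: contrapT => /eqP pi0.
    by apply: pN0; exists i.
  by rewrite p1 => /eqP; rewrite oner_eq0.
have W0 : 0 < W.
  by rewrite /W (bigD1 i0)//= ltr_pwDl// sumr_ge0// => i _; exact: ltW.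
have -> : log2 W = \sum_i p i * log2 W by rewrite -mulr_suml p1 mul1r.
rewrite -subr_le0 -!sumrB.
apply: (@le_trans _ _ (\sum_i (w i / W - p i) / ln 2)); last first.
  by rewrite -mulr_suml sumrB -mulr_suml p1 divff ?gt_eqF// subrr mul0r.
apply: ler_sum => i _; rewrite /log2 !mulrA -!mulrBl.
rewrite ler_pM2r ?invr_gt0 ?ln2_gt0//.
have [->|pi0] := eqVneq (p i) 0.
  by rewrite !mul0r !subr0 divr_ge0 ?ltW.
have pi_gt0 : 0 < p i by rewrite lt_neqAle eq_sym pi0 p0.
rewrite -!mulrBr -!ln_div ?posrE ?divr_gt0//.
have H : ln (w i / p i / W) <= w i / p i / W - 1.
  have := @le_ln1Dx _ (w i / p i / W - 1).
  by rewrite (addrC 1) subrK; apply; rewrite ltrBrDr addNr !divr_gt0.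
apply: le_trans (ler_wpM2l (p0 i) H) _.
rewrite mulrBr mulr1 -!mulrA (mulrCA (p i)) (mulrA (p i)) divff// mul1r.
by [].
Qed.

Lemma measure_bigcup_fintype d (T : measurableType d)
    (m : {measure set T -> \bar R}) (I : finType) (Q : pred I)
    (F : I -> set T) :
  (forall i, Q i -> measurable (F i)) -> trivIset [set i | Q i] F ->
  m (\bigcup_(i in [set i | Q i]) F i) = (\sum_(i | Q i) m (F i))%E.
Proof.
move=> mF tF.
rewrite measure_fin_bigcup//; last exact: finite_finset.
rewrite (_ : [set i | Q i] = [set` enum Q]); last first.
  by apply/seteqP; split => i /=; rewrite mem_enum.
by rewrite -fsbig_seq ?enum_uniq// big_enum.
Qed.

Context {dO} {Omega : measurableType dO} (P : probability Omega R).

(** Regrouping along the fibres of [h] writes both entropies as sums over [u] with the same weights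
    [p u]. Since [p u <= q (h u)], the logarithms compare term by term. *)
Lemma entropy_comp_le (U V : finType) (W : Omega -> U) (h : U -> V) :
  (forall u, measurable (W @^-1` [set u])) ->
  entropy P (h \o W) <= entropy P W.
Proof.
move=> mW; rewrite /entropy lerN2.
pose p u := fine (P (W @^-1` [set u])).
pose q v := fine (P ((h \o W) @^-1` [set v])).
have qE v : q v = \sum_(u | h u == v) p u.
  rewrite /q (_ : _ @^-1` _ =
      \bigcup_(u in [set u | h u == v]) W @^-1` [set u]).
    rewrite measure_bigcup_fintype//; last first.
      by move=> i j _ _ [x [/= <- <-]].
    by rewrite -sum_fine// => *; exact: fin_num_measure.
  apply/seteqP; split => [x /= <-|x [u /= /eqP <- <-]//].
  by exists (W x) => /=.
rewrite (_ : \sum_(v : V) _ = \sum_u p u * log2 (q (h u))); last first.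
  rewrite (partition_big h xpredT)//=. apply: eq_bigr => v _.
  by rewrite [X in X * _]qE mulr_suml; apply: eq_bigr => u /eqP ->.
apply: ler_sum => u _ /=.
have p0 u' : 0 <= p u' by rewrite fine_ge0.
rewrite -/(p u); have [->|pu0] := eqVneq (p u) 0; first by rewrite !mul0r.
have pu : 0 < p u by rewrite lt_neqAle eq_sym pu0 p0.
have pq : p u <= q (h u).
  by rewrite qE (bigD1 u)//= lerDl sumr_ge0.
rewrite ler_pM2l// ler_pM2r ?invr_gt0 ?ln2_gt0// ler_ln// posrE.
exact: lt_le_trans pq.
Qed.

(** Two uses of [entropy_comp_le]: projecting the pair by [fst] cancels the entropy of [X], and [h]
    cannot increase the entropy of [Y]. *)
Lemma mutual_info_fin_le (U V W : finType) (X : Omega -> U) (Y : Omega -> W)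
    (h : W -> V) :
  (forall u, measurable (X @^-1` [set u])) ->
  (forall w, measurable (Y @^-1` [set w])) ->
  mutual_info_fin P X (h \o Y) <= entropy P Y.
Proof.
move=> mX mY; rewrite /mutual_info_fin.
have mXY (uv : U * V) :
    measurable ((fun w => (X w, (h \o Y) w)) @^-1` [set uv]).
  rewrite (_ : _ @^-1` _ = X @^-1` [set uv.1] `&` (h \o Y) @^-1` [set uv.2]).
    apply: measurableI => //.
    rewrite (_ : _ @^-1` _ =
      \bigcup_(w in [set w | h w = uv.2]) (Y @^-1` [set w])).
      by apply: fin_bigcup_measurable => //; exact: finite_finset.
    apply/seteqP; split => [x /= hx|x [w /= <- <-]//]; first by exists (Y x).
  by case: uv => u v; apply/seteqP; split => x /= [-> ->].
have := @entropy_comp_le _ _ _ fst mXY; rewrite (_ : fst \o _ = X)// => HX.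
have := @entropy_comp_le _ _ _ h mY => HY.
lra.
Qed.

(** Constant maps into [unit] already contribute the value 0 to the supremum. *)
Lemma mutual_info_ge0 {d1 d2} {S1 : measurableType d1}
    {S2 : measurableType d2} (X : {RV P >-> S1}) (Y : {RV P >-> S2}) :
  (0 <= mutual_info X Y)%E.
Proof.
apply: ereal_sup_ubound; exists unit, unit, (fun=> tt), (fun=> tt); split.
- by move=> B; rewrite preimage_cst; case: ifP.
- by move=> B; rewrite preimage_cst; case: ifP.
rewrite /mutual_info_fin.
have E0 (U : finType) (a : U) : entropy P (fun=> a) = 0.
  rewrite /entropy big1 ?oppr0// => u _.
  rewrite preimage_cst; case: ifP => _.
    by rewrite probability_setT /= /log2 ln1 mul0r mulr0.
  by rewrite measure0 /= mul0r.
have := (E0 _ tt, E0 _ (tt, tt)) => -[E1 E2].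
by rewrite [X in X + _ - _]E1 [X in _ + X - _]E1 [X in _ - X]E2 addr0 subr0.
Qed.

(** Every quantisation [g \o Y] factors through the label [J], so each term of the supremum obeys
    the finite bound. *)
Lemma mutual_info_le_entropy {d1 d2} {S1 : measurableType d1}
    {S2 : measurableType d2} (X : {RV P >-> S1}) (Y : {RV P >-> S2})
    (W : finType) (J : Omega -> W) (y : W -> S2) :
  (forall w, measurable (J @^-1` [set w])) -> Y =1 y \o J ->
  (mutual_info X Y <= (entropy P J)%:E)%E.
Proof.
move=> mJ YE; apply: ge_ereal_sup => _ [U [V [f [g [mf mg ->]]]]].
have -> : g \o Y = (g \o y) \o J by apply/funext => w /=; rewrite YE.
rewrite lee_fin mutual_info_fin_le// => u.
exact: (measurable_funPTI X (mf [set u])).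
Qed.

End entropy_bounds.

(** * Cubes and Riemann sums *)

Section integral_bounds.
Import HBNNSimple.
Context d {T : measurableType d} {R : realType}.
Variable m : {measure set T -> \bar R}.

(* The integral of a nonnegative function is a supremum over simple functions
   below it, so the bound holds without measurability of [f]. *)
Lemma ge0_integral_le_ae_bound (D : set T) (f : T -> R) (c : R) :
  measurable D -> 0 <= c -> (forall x, 0 <= f x) ->
  {ae m, forall x, D x -> f x <= c} ->
  (\int[m]_(x in D) (f x)%:E <= c%:E * m D)%E.
Proof.
move=> mD c0 f0 fc; rewrite ge0_integralE; last by move=> x _; rewrite lee_fin.
apply: ge_ereal_sup => _ [h /= hf <-].
rewrite -integralT_nnsfun -integral_cst// [leRHS]integral_mkcond.
apply: ae_ge0_le_integral => //.
- by move=> x _; rewrite lee_fin fun_ge0.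
- by apply/measurable_EFinP; exact: measurable_funP.
- by move=> x _; rewrite patchE; case: ifP => _; rewrite lee_fin.
- by apply/(measurable_restrictT _ mD); exact: measurable_cst.
apply: filterS fc => x fc _; apply: le_trans (hf x) _.
rewrite !patchE; case: ifPn => // xD.
by rewrite lee_fin fc//; rewrite inE in xD.
Qed.

End integral_bounds.

Section cubes.
Context {R : realType} {d : nat}.
Notation leb := (lebesgueRn R d).

Definition cube_at (a : 'rV[R]_d) (L : R) : set (Rn R d) :=
  box a (a + const_mx L).

Definition grid_pt N (k : {ffun 'I_d -> 'I_N}) : 'rV[R]_d :=
  \row_i (k i)%:R.

Lemma cube_atP a L v :
  cube_at a L v <-> forall i, a ord0 i <= v ord0 i < a ord0 i + L.
Proof.
by split => h i; have := h i; rewrite in_itv /= !mxE.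
Qed.

Lemma cubeP L v : @cube R d L v <-> forall i, 0 <= v ord0 i < L.
Proof. by split => h i; have := h i; rewrite in_itv /= !mxE. Qed.

Lemma cube_at0 L : cube_at 0 L = cube L.
Proof. by rewrite /cube_at add0r. Qed.

Lemma measurable_cube_at a L : measurable (cube_at a L).
Proof. exact: measurable_box. Qed.

Lemma lebesgue_cube_at a L : 0 <= L -> leb (cube_at a L) = (L ^+ d)%:E.
Proof.
move=> L0; rewrite lebesgueRn_box => [|i]; last by rewrite !mxE lerDl.
rewrite (eq_bigr (fun=> L)) => [|i _]; first by rewrite prodr_const card_ord.
by rewrite !mxE addrAC subrr add0r.
Qed.

(** The tile containing [v] is indexed by the integer parts of the coordinates of [(v - a) / e];
    since cubes are half-open, no boundary points are lost. *)
Lemma cube_at_split a N (e : R) : 0 < e ->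
  cube_at a (N%:R * e) =
  \bigcup_(k in [set k : {ffun 'I_d -> 'I_N} | predT k])
    cube_at (a + e *: grid_pt k) e.
Proof.
move=> e0; apply/seteqP; split => [v /cube_atP va|v [k _ /cube_atP vk]].
  have lN i : (Num.truncn ((v ord0 i - a ord0 i) / e) < N)%N.
    have /andP[av vN] := va i.
    rewrite -(ltr_nat R); apply: (@le_lt_trans _ _ ((v ord0 i - a ord0 i) / e)).
      by rewrite truncn_le divr_ge0 ?subr_ge0// ltW.
    by rewrite ltr_pdivrMr// ltrBlDl.
  exists [ffun i => Ordinal (lN i)] => //; apply/cube_atP => i.
  rewrite !mxE ffunE /=; have /andP[av vN] := va i.
  have /truncn_itv/andP[] : 0 <= (v ord0 i - a ord0 i) / e.
    by rewrite divr_ge0 ?subr_ge0// ltW.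
  rewrite ler_pdivlMr// ltr_pdivrMr// -natr1 => ? ?.
  by apply/andP; split; lra.
apply/cube_atP => i; have := vk i; rewrite !mxE => /andP[h1 h2].
have k0 : 0 <= (k i)%:R :> R by [].
have kN : (k i)%:R + 1 <= N%:R :> R by rewrite natr1 ler_nat.
apply/andP; split; nra.
Qed.

Lemma trivIset_cube_at a N (e : R) : 0 < e ->
  trivIset [set k : {ffun 'I_d -> 'I_N} | predT k]
    (fun k => cube_at (a + e *: grid_pt k) e).
Proof.
move=> e0 k l _ _ [v [/cube_atP vk /cube_atP vl]].
apply/ffunP => i; apply/val_inj/eqP; rewrite eqn_leq.
have {vk} := vk i; have {vl} := vl i; rewrite !mxE => /andP[l1 l2] /andP[k1 k2].
suff : (k i < (l i).+1)%N /\ (l i < (k i).+1)%N.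
  by case=> ? ?; apply/andP; split.
by rewrite -!(ltr_nat R) -!natr1; split; rewrite -(ltr_pM2l e0); lra.
Qed.

Section cube_integrals.
Variables (f : Rn R d -> R) (B : R).
Hypothesis mf : measurable_fun setT f.
Hypothesis fB : forall u, `|f u| <= B.

Lemma integrable_cube_at a L : 0 <= L ->
  leb.-integrable (cube_at a L) (EFin \o f).
Proof.
move=> L0; apply: measurable_bounded_integrable.
- exact: measurable_cube_at.
- by rewrite [X in (X < _)%E](lebesgue_cube_at a L0) ltry.
- exact: measurable_funTS.
- exists B; split; first exact: num_real.
  by move=> x Bx u _; exact: le_trans (fB u) (ltW Bx).
Qed.

Lemma Rintegral_cube_at_split a N (e : R) : 0 < e ->
  \int[leb]_(u in cube_at a (N%:R * e)) f u =
  \sum_(k : {ffun 'I_d -> 'I_N})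
    \int[leb]_(u in cube_at (a + e *: grid_pt k) e) f u.
Proof.
move=> e0; rewrite cube_at_split//.
rewrite bigcup_pred.
rewrite /Rintegral integral_bigsetU_EFin//.
- rewrite -sum_fine// => k _.
  apply: integrable_fin_num; first exact: measurable_cube_at.
  by apply: integrable_cube_at; exact: ltW.
- by move=> k; exact: measurable_cube_at.
- exact: index_enum_uniq.
- by move=> k l _ _; exact: (trivIset_cube_at e0).
- exact/measurable_EFinP/measurable_funTS.
Qed.

Lemma Rintegral_cube_at_near a L c eta : 0 <= L ->
  (forall u, cube_at a L u -> `|f u - c| <= eta) ->
  `|\int[leb]_(u in cube_at a L) f u - L ^+ d * c| <= L ^+ d * eta.
Proof.
move=> L0 fc; have mc := measurable_cube_at a L.
have cE (r : R) : \int[leb]_(u in cube_at a L) r = L ^+ d * r.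
  by rewrite Rintegral_cst// [X in fine X](lebesgue_cube_at a L0) mulrC.
have ic (r : R) : leb.-integrable (cube_at a L) (EFin \o cst r).
  apply: measurable_bounded_integrable => //.
    by rewrite [X in (X < _)%E](lebesgue_cube_at a L0) ltry.
  exists `|r|; split; first exact: num_real.
  by move=> x rx u _; exact: ltW.
rewrite ler_distl -mulrBr -mulrDr -!cE.
have fi := integrable_cube_at a L0.
apply/andP; split.
- by apply: (le_Rintegral mc (ic _) fi) => u /fc; rewrite ler_distl => /andP[].
- by apply: (le_Rintegral mc fi (ic _)) => u /fc; rewrite ler_distl => /andP[].
Qed.

(** Each of the [N ^ d] tiles contributes an error of at most [e ^+ d * eta]. The bound sees [f]
    only through its modulus [eta], so it is uniform over the orbits of all points of [X]. *)
Lemma riemann_sum_near a N (e eta : R) : 0 < e ->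
  (forall u v, cube e v -> `|f (u + v : 'rV_d) - f u| <= eta) ->
  `|\int[leb]_(u in cube_at a (N%:R * e)) f u -
    \sum_(k : {ffun 'I_d -> 'I_N}) e ^+ d * f (a + e *: grid_pt k)| <=
  (N%:R * e) ^+ d * eta.
Proof.
move=> e0 feta; rewrite Rintegral_cube_at_split// -sumrB.
apply: (le_trans (ler_norm_sum _ _ _)).
apply: (@le_trans _ _ (\sum_(k : {ffun 'I_d -> 'I_N}) e ^+ d * eta)).
  apply: ler_sum => k _; apply: Rintegral_cube_at_near; first exact: ltW.
  move=> u /cube_atP uk; set b := a + _ in uk *.
  rewrite (_ : u = b + (u - b)); last by rewrite addrC subrK.
  apply: feta; apply/cubeP => i; have := uk i; rewrite !mxE.
  by move=> /andP[h1 h2]; apply/andP; split; lra.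
by rewrite sumr_const card_ffun !card_ord exprMn -mulrA -natrX mulr_natl.
Qed.

End cube_integrals.

(* Both sides are limits of the same Riemann sums, which replaces an appeal to
   the translation invariance of Lebesgue measure. *)
Lemma Rintegral_cube_at_shift (f : Rn R d -> R) (B : R) (b : 'rV[R]_d) (L : R) :
  measurable_fun setT f ->
  measurable_fun setT (fun u : Rn R d => f (b + u : 'rV_d)) ->
  (forall u, `|f u| <= B) ->
  (forall eta, 0 < eta -> exists2 e, 0 < e &
    forall u v, cube e v -> `|f (u + v : 'rV_d) - f u| <= eta) ->
  0 < L ->
  \int[leb]_(u in cube_at b L) f u = \int[leb]_(u in cube L) f (b + u : 'rV_d).
Proof.
move=> mf mfb fB fu L0; apply/eqP; rewrite -subr_eq0 -normr_le0.
apply/ler_addgt0Pl => eta eta0; rewrite addr0.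
have Ld : 0 < L ^+ d by rewrite exprn_gt0.
(* With this modulus each of the two integrals is within [eta / 2] of the common Riemann sum. *)
have [|e e0 he] := fu (eta / (L ^+ d) / 2); first by rewrite !divr_gt0.
(* The mesh [e'] divides [L] exactly and is at most [e]. *)
pose N := (Num.truncn (L / e)).+1; pose e' := L / N%:R.
have N0 : 0 < N%:R :> R by rewrite ltr0n.
have e'e : e' <= e.
  by rewrite ler_pdivrMr// mulrC -ler_pdivrMr// ltW// truncnS_gt.
have e'0 : 0 < e' by rewrite divr_gt0.
have he' u v : cube e' v -> `|f (u + v : 'rV_d) - f u| <= eta / L ^+ d / 2.
  move=> /cubeP ve; apply: he; apply/cubeP => i.
  by have /andP[-> /= v2] := ve i; exact: lt_le_trans e'e.
have hb (u v : 'rV[R]_d) : cube e' v ->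
    `|f (b + (u + v)) - f (b + u)| <= eta / L ^+ d / 2.
  by move=> vc; rewrite addrA; exact: he'.
have LN : L = N%:R * e' by rewrite /e' mulrC divfK// gt_eqF.
have H1 := @riemann_sum_near f B mf fB b N e' _ e'0 he'.
have H2 := @riemann_sum_near (fun u => f (b + u : 'rV_d)) B mfb
  (fun u => fB _) 0 N e' (eta / L ^+ d / 2) e'0.
have {}H2 := H2 hb.
rewrite -LN in H1; rewrite -LN cube_at0 in H2.
have : L ^+ d * (eta / L ^+ d / 2) = eta / 2.
  by field; rewrite gt_eqF.
move=> LE; rewrite LE in H1 H2.
rewrite [eta]splitr -(subrKA (\sum_(k : {ffun 'I_d -> 'I_N})
  e' ^+ d * f (b + e' *: grid_pt k))).
apply: le_trans (ler_normD _ _) (lerD H1 _).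
rewrite distrC.
under eq_bigr do rewrite -[e' *: _]add0r.
apply: H2.
Qed.

End cubes.

(** * Actions on compact spaces *)

Section continuous_actions.
Context {R : realType} {d : nat} {X : pmetricType R}.
Variable T : 'rV[R]_d -> X -> X.
Hypothesis cptX : compact [set: X].
Hypothesis actT : continuous_action T.
Notation leb := (lebesgueRn R d).

Lemma near_mdist (x : X) e : 0 < e -> \forall y \near x, mdist x y < e.
Proof.
by move=> e0; have := nbhsx_ballx x _ e0; rewrite ballEmdist.
Qed.

(** Near-covering compactness with the filter at [+oo]: near [x] every [B >= 1 + |f x|] is a bound,
    and compactness makes all large [B] work for all points at once. *)
Lemma continuous_compact_bounded (f : X -> R) : continuous f ->
  exists2 B, 0 <= B & forall x, `|f x| <= B.
Proof.
move=> cf.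
have /compact_near_coveringP/(_ _ +oo (fun B x => `|f x| <= B) _) := cptX.
move=> /(_ _)[x _|B [Br HB]].
  have : \forall x' \near x, `|f x' - f x| < 1.
    by move/cvgr_dist_lt : (cf x) => /(_ 1 ltr01); apply: filterS => y;
      rewrite distrC.
  move=> H; near=> x' B => /=.
  apply: (@le_trans _ _ (1 + `|f x|)).
    rewrite -lerBlDr; apply: le_trans (lerB_dist _ _) _.
    by apply: ltW; near: x'.
  by near: B; apply: nbhs_pinfty_ge; rewrite num_real.
exists `|B + 1| => // x; apply: HB => //.
by rewrite (lt_le_trans _ (ler_norm _))// ltrDl.
Unshelve. all: by end_near. Qed.

Lemma mdist_bounded : exists2 B, 0 <= B & forall x y : X, mdist x y <= B.
Proof.
have [B B0 HB] : exists2 B, 0 <= B & forall x : X, `|mdist (point : X) x| <= B.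
  apply: continuous_compact_bounded => x.
  apply/cvgrPdist_lt => e e0; near=> y.
  have xy : mdist x y < e by near: y; exact: near_mdist.
  have := @metric_triangle _ _ (point : X) x y.
  have := @metric_triangle _ _ (point : X) y x.
  by rewrite (metric_sym y) ltr_norml => h1 h2; apply/andP; split; lra.
exists (B + B) => [|x y]; first by rewrite addr_ge0.
rewrite (le_trans (@metric_triangle _ _ _ (point : X) _))//.
rewrite (metric_sym x) lerD//; apply: le_trans (HB _); exact: ler_norm.
Unshelve. all: by end_near. Qed.

Lemma continuous_act u : continuous (T u).
Proof.
have [cT _ _] := actT => x.
apply: (@continuous_comp _ _ _ (fun y : X => (u, y)) (fun p => T p.1 p.2)).
  by apply: (@cvg_pair _ _ _ _ (nbhs u)); [exact: cvg_cst|exact: cvg_id].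
exact: cT.
Qed.

Lemma continuous_orbit x : continuous (fun u : 'rV[R]_d => T u x).
Proof.
have [cT _ _] := actT => u.
apply: (@continuous_comp _ _ _ (fun v => (v, x)) (fun p => T p.1 p.2)).
  by apply: (@cvg_pair _ _ _ (nbhs u) (nbhs u) (nbhs x));
    [exact: cvg_id|exact: cvg_cst].
exact: cT.
Qed.

(** For [x'] near [x] and [v] near [0], both [f (T v x')] and [f x'] lie within [eta / 2] of [f x];
    compactness of [X] makes the neighbourhood of [0] the same for all [x]. *)
Lemma act_uniform (f : X -> R) : continuous f ->
  forall eta : R, 0 < eta -> exists2 e : R, 0 < e &
    forall x v, cube e v -> `|f (T v x) - f x| <= eta.
Proof.
move=> cf eta eta0; have [cT T0 _] := actT.
pose near_small (v : 'rV[R]_d) x := `|f (T v x) - f x| <= eta.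
have [e /= e0 he] : nbhs_ball (0 : 'rV[R]_d)
    (fun v => [set: X] `<=` near_small v).
  apply/nbhs_ballP; have /compact_near_coveringP covX := cptX.
  apply: (covX _ (nbhs (0 : 'rV[R]_d)) near_small) => x _.
  have H1 : \forall p \near (0 : 'rV[R]_d, x),
      `|f x - f (T p.1 p.2)| < eta / 2.
    have : f (T p.1 p.2) @[p --> (0 : 'rV[R]_d, x)] --> f x.
      have := @continuous_comp _ _ _ (fun p : 'rV[R]_d * X => T p.1 p.2) f
        (0, x) (cT _) (cf _).
      by move=> cfT; rewrite -[in X in _ --> X](T0 x); exact: cfT.
    by move/cvgr_dist_lt; apply; rewrite divr_gt0.
  have H2 : \forall y \near x, `|f x - f y| < eta / 2.
    by move/cvgr_dist_lt : (cf x); apply; rewrite divr_gt0.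
  case: H1 => -[A B] /= [A0 Bx] AB.
  near=> x' v => /=.
  have h1 : `|f x - f (T v x')| < eta / 2.
    by apply: (AB (v, x')); split => /=; [near: v|near: x'].
  have h2 : `|f x - f x'| < eta / 2 by near: x'.
  rewrite /near_small -(subrKA (f x)) (le_trans (ler_normD _ _))// [eta]splitr.
  by rewrite lerD// ltW// distrC.
exists e => // x v ve; apply: he => //.
split => // i j; rewrite (ord1 i) /= mxE /ball /= sub0r normrN.
by move/cubeP : ve => /(_ j)/andP[v0 ve]; rewrite ger0_norm.
Unshelve. all: by end_near. Qed.

(** Uniformity in [u] comes from compactness of the closed cube [K], which contains the half-open
    one. *)
Lemma act_equicontinuous (L : R) (x : X) e : 0 < e ->
  \forall y \near x, forall u, cube L u -> mdist (T u x) (T u y) < e.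
Proof.
move=> e0; have [cT T0 _] := actT.
pose K := [set u : 'rV[R]_d | forall i, `[0, L]%classic (u ord0 i)].
pose near_orbit y u := mdist (T u x) (T u y) < e.
have /compact_near_coveringP covK : compact K.
  apply: (@rV_compact R d (fun=> `[0, L]%classic)) => i.
  exact: segment_compact.
have : \forall y \near x, K `<=` near_orbit y.
  apply: (covK _ (nbhs x) near_orbit) => u _.
  have e20 : 0 < e / 2 by rewrite divr_gt0.
  have : \forall p \near (u, x), mdist (T u x) (T p.1 p.2) < e / 2.
    exact: (cT (u, x) _ (near_mdist _ e20)).
  case=> -[A B] /= [Au Bx] AB.
  near=> u' y.
  have h1 : mdist (T u x) (T u' x) < e / 2.
    apply: (AB (u', x)); split => /=; first by near: u'.
    exact: nbhs_singleton.
  have h2 : mdist (T u x) (T u' y) < e / 2.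
    by apply: (AB (u', y)); split => /=; [near: u'|near: y].
  have := @metric_triangle _ _ (T u' x) (T u x) (T u' y).
  rewrite /near_orbit (metric_sym (T u' x) (T u x)) => /le_lt_trans; apply.
  lra.
apply: filterS => y Hy u /cubeP uL; apply: Hy => i /=.
by rewrite in_itv/=; have /andP[-> /ltW] := uL i.
Unshelve. all: by end_near. Qed.

Section dist_sup_lemmas.
Variables (L : R).
Hypothesis L0 : 0 < L.
Local Notation D := (dist_sup T L).

Lemma cube0 : cube L (0 : 'rV[R]_d).
Proof. by apply/cubeP => i; rewrite mxE lexx. Qed.

Lemma le_dist_sup x y u : cube L u -> mdist (T u x) (T u y) <= D x y.
Proof.
move=> uL; apply: ub_le_sup; last by exists u.
by have [B _ HB] := mdist_bounded; exists B => _ [v _ <-].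
Qed.

Lemma dist_sup_le x y c :
  (forall u, cube L u -> mdist (T u x) (T u y) <= c) -> D x y <= c.
Proof.
move=> H; apply: ge_sup => [|_ [u uL <-]]; last exact: H.
by exists (mdist (T 0 x) (T 0 y)), 0 => //; exact: cube0.
Qed.

Lemma mdist_le_dist_sup x y : mdist x y <= D x y.
Proof.
by have [_ T0 _] := actT; have := le_dist_sup x y cube0; rewrite !T0.
Qed.

Lemma dist_sup_bounded : exists B, forall x y, D x y <= B.
Proof.
by have [B _ HB] := mdist_bounded; exists B => x y; exact: dist_sup_le.
Qed.

Lemma dist_sup_xx x : D x x = 0.
Proof.
apply/eqP; rewrite eq_le; apply/andP; split.
  by apply: dist_sup_le => u _; rewrite mdistxx.
by rewrite -(mdistxx x) mdist_le_dist_sup.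
Qed.

Lemma dist_sup_triangle x y z : D x z <= D x y + D y z.
Proof.
apply: dist_sup_le => u uL.
apply: le_trans (@metric_triangle _ _ _ (T u y) _) _.
by rewrite lerD// le_dist_sup.
Qed.

Lemma dist_sup_sym x y : D x y = D y x.
Proof.
by rewrite /dist_sup; congr sup; apply/seteqP; split => _ [u uL <-];
  exists u => //; rewrite metric_sym.
Qed.

(** One direction is equicontinuity over the cube, the other is [T 0 = id]. Hence members of covers
    are Borel sets, and compactness of [X] supplies finite covers for the metric d_L. *)
Lemma dist_sup_openE (U : set X) : dist_open D U <-> open U.
Proof.
split=> [oU|oU x Ux].
  rewrite openE => x /oU[r r0 rU].
  have r20 : 0 < r / 2 by rewrite divr_gt0.
  apply: filterS (act_equicontinuous L x r20) => y xy; apply: rU => /=.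
  apply: (@le_lt_trans _ _ (r / 2)); last lra.
  by apply: dist_sup_le => u /xy/ltW.
have /nbhs_ballP[r /= r0 rU] : nbhs x U by exact: open_nbhs_nbhs.
exists r => // y /= xy; apply: rU; rewrite ballEmdist /=.
exact: le_lt_trans (mdist_le_dist_sup _ _) xy.
Qed.

Lemma le_diam (U : set X) x y : U x -> U y -> D x y <= diam D U.
Proof.
move=> Ux Uy; apply: ub_le_sup; last by exists x => //; exists y.
by have [B HB] := dist_sup_bounded; exists B => _ [a _ [b _ <-]].
Qed.

Lemma diam_le (U : set X) c : 0 <= c ->
  (forall x y, U x -> U y -> D x y <= c) -> diam D U <= c.
Proof.
(* The empty set has diameter [sup set0 = 0], which is where [0 <= c] enters. *)
move=> c0 H; have [->|/set0P[x Ux]] := eqVneq U set0.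
  rewrite /diam (_ : [set _ | _ in _ & _ in _] = set0) ?sup0//.
  by apply/seteqP; split => // ? [].
apply: ge_sup => [|_ [a Ua [b Ub <-]]]; last exact: H.
by exists (D x x), x => //; exists x.
Qed.

End dist_sup_lemmas.

End continuous_actions.

Section borel_measurability.
Context {R : realType} {S : ptopologicalType}.

Lemma continuous_measurable_real (f : S -> R) : continuous f ->
  measurable_fun [set: borel S] (f : borel S -> R).
Proof.
move=> /continuousP cf; apply: (measurability _ (RGenOpens.measurableE R)).
move=> _ [_ [a [b ->] <-]]; rewrite setTI.
apply: sub_sigma_algebra; exact/cf/interval_open.
Qed.

Lemma continuous_measurable_borel (S' : ptopologicalType) (f : S -> S') :
  continuous f -> measurable_fun [set: borel S] (f : borel S -> borel S').
Proof.
move=> /continuousP cf.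
apply: (@measurability _ _ _ (borel S') _ _ (@open S')) => //.
by move=> _ [U oU <-]; rewrite setTI; apply: sub_sigma_algebra; exact: cf.
Qed.

End borel_measurability.

(** * Integrals of the potential along orbits over cubes *)

Section potentials.
Context {R : realType} {d : nat} {X : pmetricType R}.
Variable T : 'rV[R]_d -> X -> X.
Hypothesis cptX : compact [set: X].
Hypothesis actT : continuous_action T.
Variables (phi : X -> R) (B : R).
Hypothesis cphi : continuous phi.
Hypothesis phiB : forall x, `|phi x| <= B.
Notation leb := (lebesgueRn R d).
Local Notation pot := (potential_int T phi).

Lemma actD u v x : T (u + v) x = T v (T u x).
Proof. by have [_ _ TD] := actT; rewrite addrC TD. Qed.

Lemma continuous_observable x :
  continuous (fun u : 'rV[R]_d => phi (T u x)).
Proof.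
move=> u; apply: (@continuous_comp _ _ _ (fun u => T u x) phi).
  exact: continuous_orbit.
exact: cphi.
Qed.

Lemma measurable_observable x :
  measurable_fun [set: Rn R d] (fun u : Rn R d => phi (T u x)).
Proof. exact: (continuous_measurable_real (@continuous_observable x)). Qed.

Lemma observable_uniform eta : 0 < eta -> exists2 e : R, 0 < e &
  forall x u v, cube e v -> `|phi (T (u + v) x) - phi (T u x)| <= eta.
Proof.
move=> /(act_uniform cptX actT cphi)[e e0 he]; exists e => // x u v ve.
by rewrite actD he.
Qed.

Let phiTB x (u : Rn R d) : `|phi (T u x)| <= B.
Proof. exact: phiB. Qed.

Lemma potential_shift L x b : 0 < L ->
  \int[leb]_(u in cube_at b L) phi (T u x) = pot L (T b x).
Proof.
move=> L0; rewrite (@Rintegral_cube_at_shift _ _ _ B)//.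
- by apply: eq_Rintegral => u _ /=; rewrite actD.
- exact: measurable_observable.
- rewrite (_ : (fun _ => _) = fun u => phi (T u (T b x))).
    exact: measurable_observable.
  by apply/funext => u; rewrite actD.
- move=> eta /observable_uniform[e e0 he]; exists e => // u v; exact: he.
Qed.

Lemma potential_split N e x : 0 < e ->
  pot (N%:R * e) x =
  \sum_(k : {ffun 'I_d -> 'I_N}) pot e (T (e *: grid_pt k) x).
Proof.
move=> e0; rewrite /potential_int -cube_at0.
rewrite (Rintegral_cube_at_split (measurable_observable x) (phiTB x))//.
by apply: eq_bigr => k _; rewrite add0r potential_shift.
Qed.

Lemma potential_bound L x : 0 <= L -> `|pot L x| <= L ^+ d * B.
Proof.
move=> L0; rewrite /potential_int -cube_at0.
have := @Rintegral_cube_at_near _ _ _ _ (measurable_observable x) (phiTB x)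
  0 L 0 B L0.
by rewrite mulr0 subr0; apply => u _; rewrite subr0.
Qed.

(** Both sides are integrals of the nonnegative function [phi + B] along the orbit, over nested
    cubes. *)
Lemma potential_monotone L M x : 0 <= L -> L <= M ->
  pot L x + L ^+ d * B <= pot M x + M ^+ d * B.
Proof.
move=> L0 LM; have M0 := le_trans L0 LM.
have potE K : 0 <= K -> pot K x + K ^+ d * B =
    \int[leb]_(u in cube K) (phi (T u x) + B).
  move=> K0; rewrite -cube_at0.
  have iK := integrable_cube_at (measurable_observable x) (phiTB x) 0 K0.
  have iB : leb.-integrable (cube_at 0 K) (EFin \o cst B).
    by apply: (@integrable_cube_at _ _ (cst B) `|B|).
  rewrite RintegralD//; last exact: measurable_cube_at.
  rewrite Rintegral_cst; last exact: measurable_cube_at.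
  by rewrite [X in fine X]lebesgue_cube_at//= mulrC /potential_int cube_at0.
rewrite !potE// /Rintegral.
have mB : measurable_fun [set: Rn R d] (fun u : Rn R d => phi (T u x) + B).
  by apply: measurable_funD; [exact: measurable_observable|].
have ge0 (u : Rn R d) : 0 <= phi (T u x) + B.
  by have := phiB (T u x); rewrite ler_norml -subr_ge0 => /andP[]; lra.
have fin K : 0 <= K ->
    (\int[leb]_(u in cube K) (phi (T u x) + B)%:E)%E \is a fin_num.
  move=> K0; apply: integrable_fin_num; first exact: measurable_cube.
  rewrite -cube_at0; apply: (@integrable_cube_at _ _ _ (B + B)) => // u.
  by rewrite (le_trans (ler_normD _ _))// lerD// ger0_norm//;
    apply: le_trans (phiB (T u x)).
apply: fine_le; [exact: fin|exact: fin|].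
apply: ge0_subset_integral.
- exact: measurable_cube.
- exact: measurable_cube.
- exact/measurable_EFinP/measurable_funTS.
- by move=> u _; rewrite lee_fin.
move=> u /cubeP uL; apply/cubeP => i; have /andP[-> /= uiL] := uL i.
exact: lt_le_trans LM.
Qed.

End potentials.

(** * Covering numbers *)

Section cover_sums.
Context {R : realType}.

Lemma log2_mul (x y : R) : 0 < x -> 0 < y -> log2 (x * y) = log2 x + log2 y.
Proof. by move=> x0 y0; rewrite /log2 lnM ?posrE// mulrDl. Qed.

Lemma log2_exp (x : R) n : 0 < x -> log2 (x ^+ n) = n%:R * log2 x.
Proof. by move=> x0; rewrite /log2 lnXn// -[ln x *+ n]mulr_natl mulrA. Qed.

Lemma log2_powR (x y : R) : log2 (x `^ y) = y * log2 x.
Proof. by rewrite /log2 ln_powR mulrA. Qed.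

Lemma ler_log2 (x y : R) : 0 < x -> x <= y -> log2 x <= log2 y.
Proof.
move=> x0 xy; rewrite ler_pM2r ?invr_gt0 ?ln2_gt0// ler_ln// posrE.
exact: lt_le_trans xy.
Qed.

Lemma le_log2P (x t : R) : 0 < x -> (t <= log2 x) = (expR (t * ln 2) <= x).
Proof.
move=> x0; rewrite /log2 ler_pdivlMr ?ln2_gt0//.
by rewrite -[in RHS](lnK x0) ler_expR.
Qed.

Lemma powR_sum (I : Type) (r : seq I) (F : I -> R) (w : R) : 0 < w ->
  w `^ (\sum_(i <- r) F i) = \prod_(i <- r) w `^ (F i).
Proof.
move=> w0; elim: r => [|i r IH]; first by rewrite !big_nil powRr0.
by rewrite !big_cons powRD ?IH//; apply/implyP => _; rewrite gt_eqF.
Qed.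

Variables (S : Type) (D : S -> S -> R) (phi : S -> R) (eps : R).

Definition cover_sums : set R :=
  [set s | exists (n : nat) (U : 'I_n -> set S),
    [/\ forall i, dist_open D (U i),
        [set: S] = \bigcup_i U i,
        forall i, diam D (U i) < eps &
        s = \sum_(i < n) (eps^-1) `^ sup [set phi x | x in U i] ] ].

(** The covers built below are indexed by finite sets of centres or by finite functions; the
    enumeration by ['I_n] is done here once, and [Q] allows members to be discarded. *)
Lemma cover_sums_fintype (I : finType) (Q : pred I) (U : I -> set S) :
  (forall i, Q i -> dist_open D (U i)) ->
  (forall x, exists2 i, Q i & U i x) ->
  (forall i, Q i -> diam D (U i) < eps) ->
  cover_sums (\sum_(i | Q i) (eps^-1) `^ sup [set phi x | x in U i]).
Proof.
move=> oU cU dU.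
have QE (j : 'I_#|Q|) : Q (enum_val j) by exact: (enum_valP j).
exists #|Q|, (fun j => U (enum_val j)); split => [j||j|].
- exact: oU.
- apply/seteqP; split => // x _; have [i Qi Ui] := cU x.
  have Qi' : i \in Q by [].
  by exists (enum_rank_in Qi' i) => //; rewrite enum_rankK_in.
- exact: dU.
- exact: (big_enum_val (A := Q)).
Qed.

Hypothesis eps0 : 0 < eps.

Lemma cover_sums_ge s (x0 : S) : cover_sums s ->
  exists2 U : set S, U !=set0 & (eps^-1) `^ sup [set phi x | x in U] <= s.
Proof.
move=> [n [U [_ UT _ ->]]].
have [i _ Ui] : (\bigcup_i U i) x0 by rewrite -UT.
exists (U i); first by exists x0.
by rewrite (bigD1 i)//= lerDl sumr_ge0// => j _; exact: powR_ge0.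
Qed.

Lemma cover_sums_gt0 s (x0 : S) : cover_sums s -> 0 < s.
Proof.
move=> /(cover_sums_ge x0)[U _]; apply: lt_le_trans.
by rewrite powR_gt0 ?invr_gt0.
Qed.

Lemma cover_sum_le s : cover_sums s -> cover_sum D phi eps <= s.
Proof.
move=> Ds; apply: ge_inf => //; exists 0 => _ [n [U [_ _ _ ->]]].
by rewrite sumr_ge0// => i _; exact: powR_ge0.
Qed.

(** Exponentiating turns the bounds on all [log2 s] into one on the infimum. Positivity comes along;
    without it [log2] of the infimum would be a default value. *)
Lemma le_log2_cover_sum (x0 : S) t : cover_sums !=set0 ->
  (forall s, cover_sums s -> t <= log2 s) ->
  0 < cover_sum D phi eps /\ t <= log2 (cover_sum D phi eps).
Proof.
move=> C0 Ct.
have H : expR (t * ln 2) <= cover_sum D phi eps.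
  apply: lb_le_inf => // s Cs.
  by rewrite -le_log2P ?Ct//; exact: (cover_sums_gt0 x0 Cs).
have cs0 : 0 < cover_sum D phi eps by apply: lt_le_trans H; exact: expR_gt0.
by split => //; rewrite le_log2P.
Qed.

End cover_sums.

Section cube_subadditivity.
Context {R : realType}.

(* Fekete's argument: [G L / L ^+ d] tends to its infimum. *)
Lemma cube_subadditive_cvg (d : nat) (G : R -> R) :
  (forall L : R, 0 < L -> 0 <= G L) ->
  (forall (L M : R) N, 0 < L -> 0 < M -> L <= N%:R * M ->
    G L <= N%:R ^+ d * G M) ->
  cvg (G L / L ^+ d @[L --> +oo]).
Proof.
move=> G0 GS; pose E := [set G M / M ^+ d | M in [set M | 0 < M]].
have lbE : has_inf E.
  split; first by exists (G 1 / 1 ^+ d), 1 => //=; exact: ltr01.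
  by exists 0 => _ [M /= M0 <-]; rewrite divr_ge0 ?G0// exprn_ge0// ltW.
have infE (M : R) : 0 < M -> inf E <= G M / M ^+ d.
  by move=> M0; apply: ge_inf; [case: lbE|exists M].
apply/cvg_ex; exists (inf E); apply/cvgrPdist_le => /= e e0.
have e20 : 0 < e / 2 by rewrite divr_gt0.
have [_ [M /= M0 <-] hM] := inf_adherent e20 lbE; set h := G M / _ in hM.
have h0 : 0 <= h by rewrite divr_ge0 ?G0// exprn_ge0// ltW.
(* Rounding [L] up to a multiple of [M] costs at most the factor [(1 + M / L) ^+ d], which tends to
   1. *)
have lim0 : 1 + M * L^-1 @[L --> +oo] --> 1 + M * 0.
  apply: cvgD; first exact: cvg_cst.
  apply: cvgMl_tmp; apply/gtr0_cvgV0; last exact: cvg_id.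
  exact: nbhs_pinfty_gt.
have lim1 : (1 + M * L^-1) ^+ d * h @[L --> +oo] --> h.
  have hE : h = (1 + M * 0) ^+ d * h by rewrite mulr0 addr0 expr1n mul1r.
  rewrite [X in _ --> X]hE; apply: cvgMr_tmp.
  exact: continuous_cvg (@exprn_continuous R d _) lim0.
have h1 : \forall L \near +oo, (1 + M * L^-1) ^+ d * h <= h + e / 2.
  move/cvgrPdist_le : lim1 => /(_ _ e20); apply: filterS => L.
  by rewrite ler_distlC => /andP[_].
near=> L.
have L0 : 0 < L by near: L; exact: nbhs_pinfty_gt.
rewrite ler_distlC; apply/andP; split.
  by rewrite lerBlDr (le_trans (infE _ L0))// lerDl ltW.
apply: (@le_trans _ _ ((1 + M * L^-1) ^+ d * h)); last first.
  apply: (@le_trans _ _ (h + e / 2)); first by near: L.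
  lra.
pose N := (Num.truncn (L / M)).+1.
have LN : L <= N%:R * M by rewrite -ler_pdivrMr// ltW// truncnS_gt.
have NL : N%:R * M <= L + M.
  rewrite /N -natr1 mulrDl mul1r lerD2r -ler_pdivlMr// truncn_le.
  by rewrite divr_ge0// ltW.
rewrite ler_pdivrMr ?exprn_gt0//; apply: le_trans (GS _ _ _ L0 M0 LN) _.
have -> : (1 + M * L^-1) ^+ d * h * L ^+ d = (L + M) ^+ d * h.
  rewrite mulrAC -exprMn mulrDl mul1r mulfVK// gt_eqF//.
rewrite -[G M](@divfK _ (M ^+ d)) ?gt_eqF ?exprn_gt0//.
rewrite -/h mulrCA mulrC ler_wpM2r//.
by rewrite -exprMn lerXn2r// ?nnegrE ?mulr_ge0 ?addr_ge0// ltW.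
Unshelve. all: by end_near. Qed.

End cube_subadditivity.

(** * Existence of the limit in [L] for covering numbers *)

Section mean_dimension_limit.
Context {R : realType} {d : nat} {X : pmetricType R}.
Variable T : 'rV[R]_d -> X -> X.
Hypothesis cptX : compact [set: X].
Hypothesis actT : continuous_action T.
Variables (phi : X -> R) (B : R).
Hypothesis cphi : continuous phi.
Hypothesis phiB : forall x, `|phi x| <= B.
Local Notation pot := (potential_int T phi).
Local Notation D := (dist_sup T).
Variable eps : R.
Hypothesis eps0 : 0 < eps.
Hypothesis eps1 : eps < 1.
Local Notation w := (eps^-1).
Local Notation csums L := (cover_sums (D L) (pot L) eps).
Local Notation csum L := (cover_sum (D L) (pot L) eps).

Let w0 : 0 < w. Proof. by rewrite invr_gt0. Qed.

Let w1 : 1 < w. Proof. by rewrite invf_gt1. Qed.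

Lemma log2_invr_gt0 : 0 < log2 w.
Proof. by rewrite divr_gt0 ?ln2_gt0// ln_gt0. Qed.

Lemma potential_le_sup L (U : set X) x : 0 < L -> U x ->
  pot L x <= sup [set pot L y | y in U].
Proof.
move=> L0 Ux; apply: ub_le_sup; last by exists x.
exists (L ^+ d * B) => _ [y _ <-]; apply: le_trans (ler_norm _) _.
by apply: (potential_bound actT cphi phiB); exact: ltW.
Qed.

Lemma cover_sums_nonempty L : 0 < L -> csums L !=set0.
Proof.
(* Balls of radius [eps / 3] have diameter at most [2 * eps / 3], strictly below [eps]. *)
move=> L0; have e30 : 0 < eps / 3 by rewrite divr_gt0.
have oball x : dist_open (D L) [set y | D L x y < eps / 3].
  move=> y /= xy; exists (eps / 3 - D L x y); first by rewrite subr_gt0.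
  move=> z /= yz; apply: le_lt_trans (dist_sup_triangle T cptX L0 x y z) _.
  by rewrite -ltrBrDl.
move: (cptX); rewrite compact_cover.
move=> /(_ X setT (fun x => [set y | D L x y < eps / 3])) [x _|x _|F _ cF].
- exact/(dist_sup_openE cptX actT L0).
- by exists x => //=; rewrite dist_sup_xx.
exists (\sum_(i : F | predT i)
  w `^ sup [set pot L x | x in [set y | D L (val i) y < eps / 3]]).
apply: cover_sums_fintype => [i _|x|i _]; first exact: oball.
  have [i iF xi] := cF x I.
  by exists [` iF]%fset.
apply: (@le_lt_trans _ _ (eps / 3 + eps / 3)); last lra.
apply: diam_le => // [|x y /= xi yi]; first lra.
apply: le_trans (dist_sup_triangle T cptX L0 x (val i) y) _.
by rewrite (dist_sup_sym T _ x) lerD// ltW.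
Qed.

Lemma log2_cover_sums_ge L s : 0 < L -> csums L s ->
  - (log2 w * B * L ^+ d) <= log2 s.
Proof.
move=> L0 /(cover_sums_ge point)[U [x Ux] Us].
apply: (@le_trans _ _ (log2 (w `^ sup [set pot L x | x in U]))); last first.
  by rewrite ler_log2// powR_gt0.
rewrite log2_powR -mulrA -mulrN mulrC ler_pM2r ?log2_invr_gt0//.
apply: le_trans (potential_le_sup L0 Ux).
have := potential_bound actT cphi phiB x (ltW L0).
by rewrite ler_norml mulrC => /andP[].
Qed.

(** Pull the cover for side [M] back along the [N ^ d] grid translations and intersect, one choice
    [kappa] of members per intersection. Every [u] in the cube of side [L] lies in some tile, which
    controls diameters. The power with exponent [C] pays, through [potential_monotone], for the part
    of the tiles outside that cube. *)
Lemma cover_sums_tile L M N s : 0 < L -> 0 < M -> L <= N%:R * M ->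
  csums M s ->
  csum L <= w `^ ((N%:R * M) ^+ d * B - L ^+ d * B) * s ^+ (N ^ d).
Proof.
move=> L0 M0 LN [n [U [oU UT dU ->]]].
set C := _ - _.
pose K := {ffun 'I_d -> 'I_N}.
pose V (kappa : {ffun K -> 'I_n}) : set X :=
  [set x | forall k, U (kappa k) (T (M *: grid_pt k) x)].
(* Empty intersections must go: [sup set0 = 0] would give each of them the term 1, which the
   matching product need not dominate. *)
pose Q kappa := `[< V kappa !=set0 >].
pose S i := sup [set pot M y | y in U i].
have NM0 : 0 < N%:R * M by exact: lt_le_trans LN.
apply: (@le_trans _ _ (\sum_(kappa | Q kappa)
    w `^ sup [set pot L x | x in V kappa])).
  apply: cover_sum_le; apply: cover_sums_fintype => [kappa _|x|kappa _].
  - apply/(dist_sup_openE cptX actT L0).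
    rewrite openE => x Vx; apply: filter_forall => k.
    apply: (continuous_act actT); apply: open_nbhs_nbhs; split; last exact: Vx.
    exact/(dist_sup_openE cptX actT M0).
  - have /choice[f fP] (k : K) : exists i, U i (T (M *: grid_pt k) x).
      have [i _ Ui] : (\bigcup_i U i) (T (M *: grid_pt k) x) by rewrite -UT.
      by exists i.
    have Vx : V [ffun k => f k] x by move=> k; rewrite ffunE.
    by exists [ffun k => f k] => //; apply/asboolP; exists x.
  (* A maximum of finitely many diameters stays strictly below [eps]; bounding each distance by
     [eps] would lose strictness in the supremum. *)
  - apply: (@le_lt_trans _ _ (\big[Num.max/0]_i diam (D M) (U i))); last first.
      exact: bigmax_lt.
    apply: diam_le => // [|x y Vx Vy]; first exact: bigmax_ge_id.
    apply: dist_sup_le => // u /cubeP uL.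
    have : cube_at 0 (N%:R * M) u.
      apply/cube_atP => i; rewrite mxE add0r.
      by have /andP[-> /= uiL] := uL i; exact: lt_le_trans LN.
    rewrite cube_at_split// => -[k _]; rewrite add0r => /cube_atP uk.
    rewrite -[u](subrKC (M *: grid_pt k)) !(actD actT (M *: _)).
    apply: (@le_trans _ _ (diam (D M) (U (kappa k)))); last exact: le_bigmax.
    apply: le_trans (le_diam T cptX M0 (Vx k) (Vy k)).
    apply: (le_dist_sup T cptX); apply/cubeP => i.
    by have := uk i; rewrite !mxE => /andP[? ?]; apply/andP; split; lra.
apply: (@le_trans _ _ (\sum_(kappa : {ffun K -> 'I_n})
    w `^ C * \prod_k w `^ S (kappa k))); last first.
  (* Distributivity: summing the products over all choices [kappa] gives [N ^ d] equal factors, each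
     the covering sum at side [M]. *)
  rewrite -mulr_sumr -(bigA_distr_bigA (fun (k : K) i => w `^ S i)).
  by rewrite prodr_const card_ffun !card_ord.
rewrite big_mkcond; apply: ler_sum => kappa _.
case: ifPn => [/asboolP[x0 Vx0]|_]; last first.
  by rewrite mulr_ge0 ?powR_ge0// prodr_ge0// => k _; exact: powR_ge0.
rewrite -powR_sum// -powRD; last by apply/implyP => _; rewrite gt_eqF.
rewrite ler_powR ?(ltW w1)//; apply: ge_sup; first by exists (pot L x0), x0.
move=> _ [x Vx <-].
have := potential_monotone actT cphi phiB x (ltW L0) LN.
rewrite -lerBrDr -addrA => /le_trans; apply.
rewrite addrC lerD2l (potential_split cptX actT cphi phiB)//.
by apply: ler_sum => k _; apply: potential_le_sup => //; exact: Vx.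
Qed.

Lemma cover_sum_gt0 L : 0 < L -> 0 < csum L.
Proof.
move=> L0.
by have [] := le_log2_cover_sum eps0 point (cover_sums_nonempty L0)
  (fun s => log2_cover_sums_ge L0).
Qed.

(* Adding [log2 w * B * L ^+ d] amounts to replacing [phi] by the nonnegative
   potential [phi + B], which makes the covering numbers monotone in [L]. *)
Lemma log2_cover_sum_cvg :
  cvg (log2 (csum L) / (L ^+ d * log2 w) @[L --> +oo]).
Proof.
pose G L := log2 (csum L) + log2 w * B * L ^+ d.
have /cvg_ex[l Gl] : cvg (G L / L ^+ d @[L --> +oo]).
  apply: cube_subadditive_cvg => [L L0|L M N L0 M0 LN].
    have [_] := le_log2_cover_sum eps0 point (cover_sums_nonempty L0)
      (fun s => log2_cover_sums_ge L0).
    by rewrite /G; lra.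
  have Nd0 : 0 < (N ^ d)%:R :> R.
    rewrite ltr0n expn_gt0 -(ltr_nat R); apply/orP; left.
    rewrite -(pmulr_lgt0 _ M0); exact: lt_le_trans LN.
  (* In the logarithm of [cover_sums_tile] the [L ^+ d] terms are absorbed by [G L]; solving for
     [log2 s] gives [t], a bound free of [s] that passes to the infimum. *)
  pose t := G L / (N ^ d)%:R - log2 w * B * M ^+ d.
  have [_] : 0 < csum M /\ t <= log2 (csum M).
    apply: (le_log2_cover_sum eps0 point (cover_sums_nonempty M0)) => s Ms.
    have s0 := cover_sums_gt0 eps0 point Ms.
    have := ler_log2 (cover_sum_gt0 L0) (cover_sums_tile L0 M0 LN Ms).
    rewrite log2_mul ?powR_gt0 ?exprn_gt0// log2_exp// log2_powR => H.
    rewrite /t lerBlDr ler_pdivrMr//; apply: le_trans (lerD H (lexx _)) _.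
    by rewrite exprMn natrX; lra.
  by rewrite /t lerBlDr ler_pdivrMr// => H; rewrite mulrC -natrX.
apply/cvg_ex; exists (l / log2 w - B).
have : G L / L ^+ d / log2 w - B @[L --> +oo] --> l / log2 w - B.
  by apply: cvgB; [exact: cvgMr_tmp|exact: cvg_cst].
apply: cvg_trans; apply: near_eq_cvg; near=> L.
have L0 : 0 < L by near: L; exact: nbhs_pinfty_gt.
have Ld : L ^+ d != 0 by rewrite gt_eqF// exprn_gt0.
have lw : log2 w != 0 by rewrite gt_eqF// log2_invr_gt0.
by rewrite /G; field; rewrite Ld lw.
Unshelve. all: by end_near. Qed.

End mean_dimension_limit.

(** * Rate distortion *)

Section finite_partition_integral.
Context dO {Omega : measurableType dO} {R : realType}.
Variable m : {measure set Omega -> \bar R}.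

Lemma Rintegral_fintype (I : finType) (J : Omega -> I) (f : Omega -> R) :
  (forall i, measurable (J @^-1` [set i])) ->
  m.-integrable setT (EFin \o f) ->
  \int[m]_x f x = \sum_i \int[m]_(x in J @^-1` [set i]) f x.
Proof.
move=> mJ intf.
have TE : [set: Omega] = \big[setU/set0]_i (J @^-1` [set i]).
  by rewrite -bigcup_pred; apply/seteqP; split => // x _; exists (J x).
rewrite {1}TE /Rintegral integral_bigsetU_EFin//.
- rewrite -sum_fine// => i _; apply: integrable_fin_num; first exact: mJ.
  by apply: integrableS intf.
- exact: index_enum_uniq.
- by move=> i j _ _ [x [/= <- <-]].
- by rewrite -TE; exact: measurable_int intf.
Qed.

Lemma Rintegral_sum (I : finType) (D : set Omega) (f : I -> Omega -> R) :
  measurable D -> (forall i, m.-integrable D (EFin \o f i)) ->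
  \int[m]_(x in D) (\sum_i f i x) = \sum_i \int[m]_(x in D) f i x.
Proof.
move=> mD intf; rewrite /Rintegral.
rewrite (eq_integral (fun x => \sum_i (f i x)%:E)%E); last first.
  by move=> x _; rewrite sumEFin.
rewrite integral_sum//.
by rewrite -sum_fine// => i _; apply: integrable_fin_num => //; exact: intf.
Qed.

End finite_partition_integral.

Lemma sum_fibre_probability {R : realType} {dO} {Omega : measurableType dO}
    (P : probability Omega R) (I : finType) (J : Omega -> I) :
  (forall i, measurable (J @^-1` [set i])) ->
  \sum_i fine (P (J @^-1` [set i])) = 1.
Proof.
move=> mJ; rewrite sum_fine => [|i _]; last exact: fin_num_measure.
have trJ : trivIset [set i | predT i] (fun i => J @^-1` [set i]).
  by move=> i j _ _ [x [/= <- <-]].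
rewrite -(measure_bigcup_fintype P (fun i _ => mJ i) trJ).
rewrite (_ : \bigcup_(i in _) _ = setT).
  by rewrite [X in fine X](probability_setT P).
by apply/seteqP; split => // x _; exists (J x).
Qed.

Section rate_bound.
Context {R : realType} {d : nat} {X : pmetricType R}.
Variable T : 'rV[R]_d -> X -> X.
Hypothesis cptX : compact [set: X].
Hypothesis actT : continuous_action T.
Variables (phi : X -> R) (B : R).
Hypothesis cphi : continuous phi.
Hypothesis phiB : forall x, `|phi x| <= B.
Variable mu : probability (borel X) R.
Hypothesis invmu : invariant_measure T mu.
Local Notation pot := (potential_int T phi).
Local Notation mean := (\int[mu]_x phi x).

Lemma integrable_continuous (f : X -> R) (C : R) :
  continuous f -> (forall x, `|f x| <= C) ->
  mu.-integrable setT (EFin \o (f : borel X -> R)).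
Proof.
move=> cf fC; apply: measurable_bounded_integrable => //.
- by rewrite [X in (X < _)%E](probability_setT mu) ltry.
- exact: continuous_measurable_real.
exists C; split; first exact: num_real.
by move=> x Cx u _; exact: le_trans (fC u) (ltW Cx).
Qed.

Lemma continuous_translate v : continuous (fun x => phi (T v x)).
Proof.
move=> x; apply: (@continuous_comp _ _ _ (T v) phi).
  exact: continuous_act.
exact: cphi.
Qed.

Lemma act_preimage v (A : set X) : T v @^-1` A = [set T (- v) x | x in A].
Proof.
have [_ T0 TD] := actT.
apply/seteqP; split => [x Ax|_ [x Ax <-]].
  by exists (T v x) => //; rewrite -TD addNr T0.
by rewrite /preimage /= -TD addrN T0.
Qed.

Lemma integral_translate v : \int[mu]_x phi (T v x) = mean.
Proof.
have mT : measurable_fun [set: borel X] (T v : borel X -> borel X).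
  by apply: continuous_measurable_borel; exact: continuous_act.
rewrite /Rintegral; congr fine.
rewrite -(preimage_setT (T v)).
rewrite -(integral_pushforward (f := EFin \o (phi : borel X -> R)) mT)//.
- apply: eq_measure_integral => A mA _.
  transitivity (mu (T v @^-1` A)); first by [].
  by rewrite act_preimage; exact: invmu.
- by apply/measurable_EFinP; exact: continuous_measurable_real.
- rewrite preimage_setT.
  exact: (integrable_continuous (@continuous_translate v) (fun x => phiB _)).
Qed.

(* Riemann sums of [u |-> phi (T u x)] approximate the potential uniformly in
   [x] and have integral [L ^+ d * mean] by invariance, so Fubini's theorem is
   not needed. *)
Lemma potential_mean_le L (I : finType) (J : borel X -> I) (s : I -> R) :
  0 < L -> (forall i, measurable (J @^-1` [set i])) ->
  (forall x, pot L x <= s (J x)) ->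
  L ^+ d * mean <= \sum_i fine (mu (J @^-1` [set i])) * s i.
Proof.
move=> L0 mJ Js; have Ld0 : 0 < L ^+ d by rewrite exprn_gt0.
apply/ler_addgt0Pr => e e0; set eta := e / L ^+ d.
have eta0 : 0 < eta by rewrite divr_gt0.
have [h h0 hu] := observable_uniform cptX actT cphi eta0.
pose N := (Num.truncn (L / h)).+1; pose h' := L / N%:R.
have N0 : 0 < N%:R :> R by rewrite ltr0n.
have h'h : h' <= h.
  by rewrite ler_pdivrMr// mulrC -ler_pdivrMr// ltW// truncnS_gt.
have h'0 : 0 < h' by rewrite divr_gt0.
have LN : L = N%:R * h' by rewrite /h' mulrC divfK// gt_eqF.
pose K := {ffun 'I_d -> 'I_N}.
pose S (x : borel X) := \sum_(k : K) h' ^+ d * phi (T (h' *: grid_pt k) x).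
have hu' x (u v : Rn R d) : cube h' v ->
    `|phi (T (u + v : 'rV_d) x) - phi (T u x)| <= eta.
  move=> /cubeP vh; apply: hu; apply/cubeP => i.
  by have /andP[-> /= ?] := vh i; exact: lt_le_trans h'h.
have Snear x : S x <= pot L x + e.
  have := @riemann_sum_near _ _ _ B
    (measurable_observable actT cphi x) (fun u => phiB _) 0 N h' eta h'0.
  rewrite -LN cube_at0 => /(_ (hu' x)).
  under eq_bigr do rewrite add0r.
  rewrite ler_distlC /eta (mulrC _ (e / _)) divfK ?gt_eqF//.
  by case/andP.
have cS : continuous S.
  move=> x; apply: cvg_big => [|k _]; first exact: add_continuous.
  apply: cvgMl_tmp.
  exact: continuous_translate.
have SB x : `|S x| <= \sum_(k : K) h' ^+ d * B.
  apply: le_trans (ler_norm_sum _ _ _) _; apply: ler_sum => k _.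
  have h'd : 0 < h' ^+ d by rewrite exprn_gt0.
  by rewrite normrM gtr0_norm// ler_pM2l.
have iS := integrable_continuous cS SB.
have -> : L ^+ d * mean = \int[mu]_x S x.
  have iT v : mu.-integrable setT (EFin \o (fun x : borel X => phi (T v x))).
    exact: (integrable_continuous (@continuous_translate v) (fun x => phiB _)).
  rewrite Rintegral_sum//; last first.
    by move=> k; exact: (integrableZl measurableT (h' ^+ d) (iT _)).
  under eq_bigr do rewrite RintegralZl// integral_translate.
  rewrite sumr_const card_ffun !card_ord -mulr_natl natrX mulrA -exprMn.
  by rewrite -LN.
rewrite (Rintegral_fintype mJ iS).
have mu1 : \sum_i fine (mu (J @^-1` [set i])) = 1.
  exact: sum_fibre_probability.
(* The error [e] is distributed over the fibres of [J] according to their probabilities; on each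
   fibre [S] is at most [s i + e]. *)
rewrite -[e in leRHS]mul1r -mu1 mulr_suml -big_split/=.
apply: ler_sum => i _; rewrite -mulrDr.
rewrite mulrC -Rintegral_cst//; apply: le_Rintegral => //.
- exact: integrableS iS.
- exact: finite_measure_integrable_cst.
move=> x /= <-; apply: le_trans (Snear x) _; by rewrite lerD2r.
Qed.

End rate_bound.

Section ae_classes.
Context d1 d2 {T1 : measurableType d1} {T2 : measurableType d2} {R : realType}.
Variable m : {measure set T1 -> \bar R}.

(** [aqEqMfun_to_fun] evaluates a chosen representative of the class, which agrees with [g] only
    almost everywhere. *)
Lemma aeEqMfun_piE (g : {mfun T1 >-> T2}) :
  {ae m, forall u, aqEqMfun_to_fun (\pi_({mfun_ m, T1 >-> T2}) g)%qT u = g u}.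
Proof.
set q := (\pi_({mfun_ m, T1 >-> T2}) g)%qT.
have /eqP : (\pi_({mfun_ m, T1 >-> T2}) (repr q) = q)%qT by rewrite reprK.
rewrite eqmodE => /asboolP; apply: filterS => u; exact.
Qed.

Lemma ae_mrestr (A : set T1) (mA : measurable A) (Q : T1 -> Prop) :
  {ae mrestr m mA, forall u, Q u} -> {ae m, forall u, A u -> Q u}.
Proof.
move=> [N [mN N0 QN]]; exists (N `&` A); split => //; first exact: measurableI.
by move=> u /= /not_implyP[Au Qu]; split => //; exact: QN.
Qed.

End ae_classes.

(** * From a finite cover to a bound on the rate *)

Section rate_upper_bound.
Context {R : realType} {d : nat} {X : pmetricType R}.
Variable T : 'rV[R]_d -> X -> X.
Hypothesis cptX : compact [set: X].
Hypothesis actT : continuous_action T.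
Variables (phi : X -> R) (B : R).
Hypothesis cphi : continuous phi.
Hypothesis phiB : forall x, `|phi x| <= B.
Variable mu : probability (borel X) R.
Hypothesis invmu : invariant_measure T mu.
Variables (L eps : R).
Hypothesis L0 : 0 < L.
Hypothesis eps0 : 0 < eps.
Hypothesis eps1 : eps < 1.
Notation leb := (lebesgueRn R d).
Local Notation pot := (potential_int T phi).
Local Notation mean := (\int[mu]_x phi x).
Local Notation D := (dist_sup T L).
Local Notation cubeL := (@measurable_cube R d L).

Let orbit (x : X) : Rn R d -> borel X := fun u => T u x.

Let measurable_orbit x : measurable_fun setT (orbit x).
Proof.
by apply: continuous_measurable_borel; exact: continuous_orbit.
Qed.

Definition orbit_mfun x : {mfun Rn R d >-> borel X} :=
  HB.pack_for {mfun Rn R d >-> borel X} (orbit x)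
    (isMeasurableFun.Build _ _ _ _ _ (measurable_orbit x)).

Definition orbit_class (x : X) : L1 cubeL := (\pi_(L1 cubeL) (orbit_mfun x))%qT.

Lemma orbit_classE x :
  {ae leb, forall u, cube L u -> L1_fun (orbit_class x) u = T u x}.
Proof.
apply: (@ae_mrestr _ _ _ leb _ cubeL); exact: (aeEqMfun_piE _ (orbit_mfun x)).
Qed.

Lemma distortion_ge0 (x : X) (f : L1 cubeL) : 0 <= distortion T x f.
Proof.
rewrite /distortion mulr_ge0 ?invr_ge0 ?fine_ge0//.
by apply: integral_ge0 => u _; rewrite lee_fin mdist_ge0.
Qed.

(** An average over the cube is at most the supremum. The estimate is made in [\bar R], where it
    also gives the finiteness required to read off [fine]. *)
Lemma distortion_orbit_class x y :
  distortion T x (orbit_class y) <= D x y.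
Proof.
have Ld0 : 0 < L ^+ d by rewrite exprn_gt0.
have lebL : leb (cube L) = (L ^+ d)%:E.
  by rewrite -cube_at0 lebesgue_cube_at// ltW.
have D0 : 0 <= D x y.
  exact: le_trans (mdist_ge0 _ _) (mdist_le_dist_sup cptX actT L0 x y).
rewrite /distortion [X in fine X]lebL/= ler_pdivrMl//.
have : (\int[leb]_(u in cube L) (mdist (T u x) (L1_fun (orbit_class y) u))%:E
    <= (D x y)%:E * leb (cube L))%E.
  apply: ge0_integral_le_ae_bound => //; first exact: measurable_cube.
  - by move=> u; exact: mdist_ge0.
  - apply: filterS (orbit_classE y) => u uE uL.
    by rewrite uE//; exact: le_dist_sup.
rewrite lebL -EFinM => H; rewrite mulrC /Rintegral -lee_fin fineK//.
rewrite ge0_fin_numE; first exact: le_lt_trans H (ltry _).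
by apply: integral_ge0 => u _; rewrite lee_fin; exact: mdist_ge0.
Qed.

Lemma rate_ge0 : (0 <= rate T mu eps cubeL)%E.
Proof.
apply: le_ereal_inf_tmp => _ [dO [Om [P [x [y [_ _ ->]]]]]].
exact: mutual_info_ge0.
Qed.

(** The label is computed from the membership pattern [W x], and each pattern occurs on a finite
    intersection of open sets and complements of open sets. The default [i0] is never selected, as
    the sets cover [X]. *)
Lemma cover_selection n (U : 'I_n -> set X) :
  (forall i, open (U i)) -> [set: X] = \bigcup_i U i ->
  exists2 J : borel X -> 'I_n,
    forall i, measurable (J @^-1` [set i]) & forall x, U (J x) x.
Proof.
move=> oU UT.
have [i0 _ _] : (\bigcup_i U i) point by rewrite -UT.
pose W (x : borel X) : {ffun 'I_n -> bool} := [ffun i => `[< U i x >]].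
pose f (b : {ffun 'I_n -> bool}) : 'I_n := odflt i0 [pick i | b i].
exists (f \o W) => [i|x].
  rewrite (_ : _ @^-1` _ = \bigcup_(b in [set b | f b = i]) W @^-1` [set b]).
    apply: fin_bigcup_measurable => [|b _]; first exact: finite_finset.
    rewrite (_ : _ @^-1` _ =
      \bigcap_(j in [set: 'I_n]) (if b j then U j else ~` U j)).
      apply: fin_bigcap_measurable => [|j _]; first exact: finite_finset.
      have mU : measurable (U j : set (borel X)) by exact: sub_sigma_algebra.
      by case: (b j) => //; exact: measurableC.
    apply/seteqP; split => [x /= <- j _|x /= Wx].
      by rewrite ffunE; case: ifPn => /asboolP.
    apply/ffunP => j; rewrite ffunE; have := Wx j I.
    by case: (b j) => Ujx; apply/asboolP.
  by apply/seteqP; split => [x /= <-|x [b /= <- <-]//]; exists (W x).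
rewrite /= /f; case: pickP => [i|/= H]; first by rewrite ffunE => /asboolP.
have [i _ Ui] : (\bigcup_i U i) x by rewrite -UT.
by have := H i; rewrite ffunE => /asboolP.
Qed.

Lemma rate_le_cover_sums s : cover_sums D (pot L) eps s ->
  (rate T mu eps cubeL <= (log2 s - log2 eps^-1 * mean * L ^+ d)%:E)%E.
Proof.
move=> [n [U [oU UT dU ->]]].
have oU' i : open (U i) by exact/(dist_sup_openE cptX actT L0).
have [J mJ UJ] := cover_selection oU' UT.
(* The default [point] is taken only on empty fibres, which no [J x] reaches. *)
pose z i : X := xget point (J @^-1` [set i]).
have Uz x : U (J x) (z (J x)).
  by rewrite /z; case: xgetP => [y _ /= <-|/(_ x) []//]; exact: UJ.
pose y0 i : borel_L1 cubeL := orbit_class (z i).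
have mY : measurable_fun [set: borel X] (y0 \o J).
  move=> _ V mV; rewrite setTI.
  rewrite (_ : _ @^-1` _ = \bigcup_(i in [set i | V (y0 i)]) J @^-1` [set i]).
    by apply: fin_bigcup_measurable => //; exact: finite_finset.
  apply/seteqP; split => [x /= Vx|x [i Vi /= Jx]]; first by exists (J x).
  by rewrite /preimage /= Jx.
pose Y : {RV mu >-> borel_L1 cubeL} := HB.pack_for
  {mfun borel X >-> borel_L1 cubeL} (y0 \o J)
  (isMeasurableFun.Build _ _ _ _ _ mY).
pose x0 : {RV mu >-> borel X} := HB.pack_for
  {mfun borel X >-> borel X} (@id (borel X))
  (isMeasurableFun.Build _ _ _ _ _ (@measurable_id _ (borel X) setT)).
apply: (@le_trans _ _ (mutual_info x0 Y)).
  apply: ereal_inf_lbound; exists _, (borel X), mu, x0, Y; split => //.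
  (* The distortion constraint is strict, so the pointwise bound is the largest diameter [m < eps],
     uniform in the point. *)
  pose m := \big[Num.max/0]_i diam D (U i).
  have meps : m < eps by exact: bigmax_lt.
  apply: (@le_lt_trans _ _ m%:E); last by rewrite lte_fin.
  rewrite unlock; have -> : m%:E = (m%:E * mu setT)%E.
    by rewrite probability_setT mule1.
  apply: ge0_integral_le_ae_bound => //; first exact: bigmax_ge_id.
  - by move=> w; exact: distortion_ge0.
  - apply: aeW => w _ /=; apply: le_trans (distortion_orbit_class _ _) _.
    apply: le_trans (le_bigmax _ _ (J w)).
    by apply: le_diam.
apply: le_trans (mutual_info_le_entropy x0 (y := y0) mJ _) _ => //.
rewrite lee_fin.
pose S i := sup [set pot L x | x in U i].
pose p i := fine (mu (J @^-1` [set i])).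
have p0 i : 0 <= p i by exact: fine_ge0.
have p1 : \sum_i p i = 1 by exact: sum_fibre_probability.
have w0 i : 0 < eps^-1 `^ S i by rewrite powR_gt0 ?invr_gt0.
have := gibbs_inequality p0 p1 w0.
under eq_bigr do rewrite log2_powR mulrA.
rewrite -mulr_suml.
have : L ^+ d * mean <= \sum_i p i * S i.
  apply: (potential_mean_le cptX actT cphi phiB invmu L0 mJ) => x.
  exact: (potential_le_sup actT cphi phiB L0 (UJ x)).
have lw := log2_invr_gt0 eps0 eps1.
move=> H1 H2; rewrite lerBrDr; apply: le_trans H2.
rewrite addrC lerD2r -mulrA (mulrC (log2 _)) ler_pM2r//.
by rewrite mulrC.
Qed.

(** A single cover makes the rate finite; the bound for every covering sum, read as a lower bound on
    [log2 s], then passes to the infimum. *)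
Lemma rate_le_cover_sum :
  exists2 r : R, rate T mu eps cubeL = r%:E &
    0 <= r <= log2 (cover_sum D (pot L) eps) - log2 eps^-1 * mean * L ^+ d.
Proof.
have C0 := cover_sums_nonempty cptX actT phi eps0 L0.
have [s Cs] := C0.
have rfin : rate T mu eps cubeL \is a fin_num.
  rewrite ge0_fin_numE ?rate_ge0//.
  exact: le_lt_trans (rate_le_cover_sums Cs) (ltry _).
exists (fine (rate T mu eps cubeL)); first by rewrite fineK.
rewrite fine_ge0 ?rate_ge0//= lerBrDr.
apply: (proj2 (le_log2_cover_sum eps0 point C0 _)) => s' /rate_le_cover_sums.
by rewrite -[X in (X <= _)%E](fineK rfin) lee_fin lerBrDr.
Qed.

End rate_upper_bound.

(** * Main inequality *)

Section limf_shift.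
Context {T : choiceType} {X : filteredType T} {R : realType}.
Variables (F : set_system X) (f g : X -> \bar R) (c : R).
Local Open Scope ereal_scope.

(** The upper limit is an infimum of suprema over members of [F], and each member may be shrunk to
    the set where the inequality holds. *)
Lemma limf_esup_shift_le {FF : Filter F} :
  (\forall x \near F, f x + c%:E <= g x) ->
  limf_esup f F + c%:E <= limf_esup g F.
Proof.
move=> fg; apply: le_ereal_inf_tmp => _ [V FV <-].
rewrite -leeBrDr//.
apply: (@le_trans _ _ (ereal_sup (f @` (V `&` [set x | f x + c%:E <= g x])))).
  by apply: ereal_inf_lbound; eexists; [exact: filterI FV fg|].
apply: ge_ereal_sup => _ [x [Vx fgx] <-]; rewrite leeBrDr//.
by apply: le_trans fgx _; apply: ereal_sup_ubound; exists x.
Qed.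

End limf_shift.

Lemma limf_einf_shift_le {T : choiceType} {X : filteredType T} {R : realType}
    (F : set_system X) (f g : X -> \bar R) (c : R) {FF : Filter F} :
  (\forall x \near F, f x + c%:E <= g x)%E ->
  (limf_einf f F + c%:E <= limf_einf g F)%E.
Proof.
(* The lower limit is minus the upper limit of the negation, so the roles of [f] and [g] are
   exchanged. *)
move=> fg; have : (limf_esup (\- g) F + c%:E <= limf_esup (\- f) F)%E.
  apply: limf_esup_shift_le; apply: filterS fg => x fgx.
  by rewrite /= -leeN2 oppeK fin_num_oppeD// oppeK leeBrDr.
rewrite /limf_einf -[in X in _ -> X]leeN2 oppeK fin_num_oppeD// oppeK.
by rewrite leeBrDr.
Qed.

Section scale_inequality.
Context {R : realType} {d : nat} {X : pmetricType R}.
Variable T : 'rV[R]_d -> X -> X.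
Hypothesis cptX : compact [set: X].
Hypothesis actT : continuous_action T.
Variables (phi : X -> R) (cphi : continuous phi).
Variable mu : probability (borel X) R.
Hypothesis invmu : invariant_measure T mu.

(* The limit defining [rate_distortion] need not be shown to exist: the [lim]
   of a divergent function is [0], and the bound then follows from the
   nonnegativity of the rates. *)
Lemma rate_distortion_le_mdim_scale eps : 0 < eps -> eps < 1 ->
  (rate_distortion T mu eps * ((log2 eps^-1)^-1)%:E + (\int[mu]_x phi x)%:E
    <= mdim_scale T phi eps)%E.
Proof.
move=> eps0 eps1; have [B B0 phiB] := continuous_compact_bounded cptX cphi.
set c := \int[mu]_x phi x; set lw := log2 eps^-1.
have lw0 : 0 < lw by exact: log2_invr_gt0.
pose g L := log2 (cover_sum (dist_sup T L) (potential_int T phi L) eps).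
have /cvg_ex[m gm] := log2_cover_sum_cvg cptX actT cphi phiB eps0 eps1.
have -> : mdim_scale T phi eps = m%:E.
  by apply/cvg_lim => //; apply: cvg_EFin gm; exact: nearW.
have rate_le L : 0 < L -> exists2 r : R,
    rate T mu eps (@measurable_cube R d L) = r%:E &
    0 <= r / L ^+ d <= (g L / (L ^+ d * lw) - c) * lw.
  move=> L0; have [r rE /andP[r0 rg]] :=
    rate_le_cover_sum cptX actT cphi phiB invmu L0 eps0 eps1.
  have Ld0 : 0 < L ^+ d by rewrite exprn_gt0.
  exists r => //; apply/andP; split; first by rewrite divr_ge0// ltW.
  rewrite ler_pdivrMr//; apply: le_trans rg _; rewrite -/lw -/c -/(g L).
  rewrite le_eqVlt; apply/orP; left; apply/eqP.
  by field; rewrite !gt_eqF.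
(* Nonnegative rates force [c <= m] in the limit; this makes the bound nonnegative, as the divergent
   case demands. *)
have cm : c <= m.
  rewrite -(cvg_lim _ gm)//; apply: limr_ge; first by apply/cvg_ex; exists m.
  near=> L; have L0 : 0 < L by near: L; exact: nbhs_pinfty_gt.
  have [r _ /andP[r0 rg]] := rate_le _ L0.
  by have := le_trans r0 rg; rewrite pmulr_lge0// subr_ge0.
suff : (rate_distortion T mu eps <= ((m - c) * lw)%:E)%E.
  move=> H.
  rewrite -leeBrDr// -EFinB.
  apply: (@le_trans _ _ (((m - c) * lw)%:E * lw^-1%:E)%E).
    by rewrite lee_wpmul2r// lee_fin invr_ge0 ltW.
  by rewrite -EFinM mulfK// gt_eqF.
have [cv|ncv] := pselect (cvg ((rate T mu eps (measurable_cube L) *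
    ((L ^+ d)^-1)%:E)%E @[L --> +oo%R])); last first.
  rewrite /rate_distortion (dvgP ncv).
  by rewrite lee_fin mulr_ge0 ?subr_ge0// ltW.
have gm' : ((g L / (L ^+ d * lw) - c) * lw)%:E @[L --> +oo%R] -->
    ((m - c) * lw)%:E.
  apply: cvg_EFin; first exact: nearW.
  by apply: cvgMr_tmp; apply: cvgB => //; exact: cvg_cst.
have limE := cvg_lim (@ereal_hausdorff R) gm'.
rewrite -[leRHS]limE; apply: lee_lim => //.
  by apply/cvg_ex; eexists; exact: gm'.
near=> L; have L0 : 0 < L by near: L; exact: nbhs_pinfty_gt.
by have [r -> /andP[_ rg]] := rate_le _ L0; rewrite -EFinM lee_fin.
Unshelve. all: by end_near. Qed.

End scale_inequality.

Theorem proposition3p5 (R : realType) (d : nat) (hd : (1 <= d)%N)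
    (X : pmetricType R) (cptX : compact [set: X])
    (T : 'rV[R]_d -> X -> X) (actT : continuous_action T)
    (phi : X -> R) (cphi : continuous phi)
    (mu : probability (borel X) R) (invmu : invariant_measure T mu) :
  (upper_rdim T mu + \int[mu]_x (phi x)%:E <= upper_mdim T phi)%E /\
  (lower_rdim T mu + \int[mu]_x (phi x)%:E <= lower_mdim T phi)%E.
Proof.
have [B B0 phiB] := continuous_compact_bounded cptX cphi.
have -> : (\int[mu]_x (phi x)%:E)%E = (\int[mu]_x phi x)%:E.
  by rewrite fineK//; apply: integrable_fin_num => //;
    exact: integrable_continuous cphi phiB.
have scale : \forall eps \near (0 : R)^'+,
    (rate_distortion T mu eps * ((log2 eps^-1)^-1)%:E + (\int[mu]_x phi x)%:E
      <= mdim_scale T phi eps)%E.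
  near=> eps; have eps0 : 0 < eps by [].
  have eps1 : eps < 1 by near: eps; exact: nbhs_right_lt.
  exact: rate_distortion_le_mdim_scale.
by split; [exact: limf_esup_shift_le|exact: limf_einf_shift_le].
Unshelve. all: by end_near. Qed.
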